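(* Let $1 \le p \le \infty$, $\gamma > 1$, $\delta > 0$ and $C > 1$. If there is an algorithm for $\gamma$-ANN under the $\ell_p$ norm with preprocessing time $N^C$ and query time $N^{1-\delta}$, where $N$ is the number of data points, then there is an algorithm for $\gamma$-$\mathsf{SVP}_p^{\{0,1\}}$ with the same ambient dimension running in time $2^{(1 - \delta')n}$ for some $\delta' = \Omega\!\left(\frac{\delta}{C-1}\right)$, where $n$ denotes the rank of the input lattice.
   Context: $\gamma$-ANN (Approximate Nearest Neighbor Search) under the $\ell_p$ norm: a set $A \subset \mathbb{R}^d$ of $N$ points is first preprocessed; then, given numbers $\gamma > 1$, $r > 0$ and a query $x \in \mathbb{R}^d$, one must distinguish between (YES) there exists $a \in A$ with $\|a-x\|_p \le r$, and (NO) for all $a \in A$, $\|a - x\|_p \ge \gamma r$. The problem $\gamma$-$\mathsf{SVP}_p^{\{0,1\}}$: given linearly independent vectors $b_1, \ldots, b_n \in \mathbb{R}^d$ (a lattice basis of rank $n$, ambient dimension $d$) and numbers $\gamma > 1$, $r > 0$, distinguish between (YES) there exists a nonzero $\alpha \in \{0,1\}^n$ with $\|\sum_i \alpha_i b_i\|_p \le r$, and (NO) for every nonzero $\alpha \in \mathbb{Z}^n$, $\|\sum_i \alpha_i b_i\|_p \ge \gamma r$.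
   Formalization: The constant in Ω(δ/(C−1)) is uniform for C ≥ C0, for each fixed C0 > 1 (an absolute constant would force δ' > 1 as C → 1), and all running times are for deterministic real-RAM programs, up to constant and poly(d) factors. *)

(* Defs.v *)
From HB Require Import structures.
From mathcomp Require Import all_boot all_order all_algebra.
From mathcomp Require Import reals ereal exp.

Set Implicit Arguments.
Unset Strict Implicit.
Unset Printing Implicit Defensive.

Import Order.TTheory GRing.Theory Num.Theory.
Local Open Scope ring_scope.

(** * The l_p norm on R^d, for p in [1, +oo] *)

(* The value at p = -oo is junk; it is only used for 1 <= p. *)
Definition lp_norm (R : realType) (p : \bar R) (d : nat) (v : 'rV[R]_d) : R :=
  match p with
  | EFin q => (\sum_j `|v 0 j| `^ q) `^ q^-1
  | +oo%E => \big[Num.max/0]_j `|v 0 j|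
  | -oo%E => 0
  end.

(** * The machine model: a real RAM

    The memory consists of two families of arrays indexed by [nat], one holding
    natural numbers (used for control and addressing), one holding exact real
    numbers.  A program is a closed syntactic object, so it mentions only
    finitely many arrays and contains no real constant (a real constant could
    hide an infinite advice string).

    As usual for unit-cost machines, the instruction set is kept from being
    absurdly strong: natural numbers have no unit-cost multiplication and there
    is no rounding of a real to a natural number (either would allow arithmetic
    on exponentially long bit strings in polynomial time).  The unary primitive
    [RPow] makes l_p norms comparable on the machine for every p. *)

Record store (R : realType) := Store {
  imem : nat -> nat -> nat;  (* [imem s a i] is cell i of integer array a *)
  rmem : nat -> nat -> R     (* [rmem s a i] is cell i of real array a *)
}.

Inductive iexp : Type :=
| INum of nat
| IGet of nat & iexp
| IAdd of iexp & iexp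
| ISub of iexp & iexp.       (* truncated *)

Inductive rexp : Type :=
| RNat of iexp
| RGet of nat & iexp
| RAdd of rexp & rexp
| ROpp of rexp
| RMul of rexp & rexp
| RInv of rexp               (* the inverse of 0 is 0 *)
| RPow of rexp.              (* |x|^p, or |x| when p = +oo *)

Inductive bexp : Type :=
| ILe of iexp & iexp
| RLe of rexp & rexp
| BNot of bexp
| BAnd of bexp & bexp.

Inductive cmd : Type :=
| Skip
| ISet of nat & iexp & iexp
| RSet of nat & iexp & rexp
| Seq of cmd & cmd
| If of bexp & cmd & cmd
| While of bexp & cmd.

Section Semantics.
Variables (R : realType) (p : \bar R).

Fixpoint ieval (s : store R) (e : iexp) : nat :=
  match e with
  | INum n => n
  | IGet a e1 => imem s a (ieval s e1)
  | IAdd e1 e2 => (ieval s e1 + ieval s e2)%N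
  | ISub e1 e2 => (ieval s e1 - ieval s e2)%N
  end.

Definition pow_prim (x : R) : R :=
  if p is EFin q then `|x| `^ q else `|x|.

Fixpoint reval (s : store R) (e : rexp) : R :=
  match e with
  | RNat e1 => (ieval s e1)%:R
  | RGet a e1 => rmem s a (ieval s e1)
  | RAdd e1 e2 => reval s e1 + reval s e2
  | ROpp e1 => - reval s e1
  | RMul e1 e2 => reval s e1 * reval s e2
  | RInv e1 => (reval s e1)^-1
  | RPow e1 => pow_prim (reval s e1)
  end.

Fixpoint beval (s : store R) (e : bexp) : bool :=
  match e with
  | ILe e1 e2 => (ieval s e1 <= ieval s e2)%N
  | RLe e1 e2 => reval s e1 <= reval s e2
  | BNot e1 => ~~ beval s e1
  | BAnd e1 e2 => beval s e1 && beval s e2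
  end.

Definition upd (T : Type) (m : nat -> nat -> T) (a i : nat) (v : T) :
    nat -> nat -> T :=
  fun a' i' => if (a' == a) && (i' == i) then v else m a' i'.

Definition iset (s : store R) (a i n : nat) : store R :=
  Store (upd (imem s) a i n) (rmem s).

Definition rset (s : store R) (a i : nat) (x : R) : store R :=
  Store (imem s) (upd (rmem s) a i x).

(* [exec c s t s']: started in [s], [c] halts in [s'] after [t] steps.  Every
   assignment and every evaluation of a test is one step; since the expressions
   occurring in a program have bounded size, this is the number of elementary
   operations up to a constant depending on the program only. *)
Inductive exec : cmd -> store R -> nat -> store R -> Prop :=
| ExecSkip s : exec Skip s 1 s
| ExecISet s a i e :
    exec (ISet a i e) s 1 (iset s a (ieval s i) (ieval s e))
| ExecRSet s a i e :
    exec (RSet a i e) s 1 (rset s a (ieval s i) (reval s e))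
| ExecSeq c1 c2 s1 s2 s3 t1 t2 :
    exec c1 s1 t1 s2 -> exec c2 s2 t2 s3 ->
    exec (Seq c1 c2) s1 (t1 + t2) s3
| ExecIfTrue b c1 c2 s s' t :
    beval s b -> exec c1 s t s' -> exec (If b c1 c2) s t.+1 s'
| ExecIfFalse b c1 c2 s s' t :
    ~~ beval s b -> exec c2 s t s' -> exec (If b c1 c2) s t.+1 s'
| ExecWhileFalse b c s :
    ~~ beval s b -> exec (While b c) s 1 s
| ExecWhileTrue b c s1 s2 s3 t1 t2 :
    beval s1 b -> exec c s1 t1 s2 -> exec (While b c) s2 t2 s3 ->
    exec (While b c) s1 (t1 + t2).+1 s3.

End Semantics.

(** * Input and output conventions *)

(* Row-major: entry (i, j) of an m x d matrix is at position i * d + j. *)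
Definition flat (R : realType) (m d : nat) (A : 'M[R]_(m, d)) : seq R :=
  [seq A i j | i <- enum 'I_m, j <- enum 'I_d].

(* Integer array 0 is m, d, 0, 0, ...; real array 0 holds the entries of the
   matrix; every other cell is 0. *)
Definition matrix_store (R : realType) (m d : nat) (A : 'M[R]_(m, d)) :
    store R :=
  Store (fun a i => if a == 0%N then nth 0%N [:: m; d] i else 0%N)
        (fun a i => if a == 0%N then nth 0 (flat A) i else 0).

(* Overwrites the first cells of real array a by the elements of l. *)
Definition load (R : realType) (s : store R) (a : nat) (l : seq R) : store R :=
  Store (imem s)
    (fun a' i => if (a' == a) && (i < size l)%N then nth 0 l i else rmem s a' i).

(* The answer is read in cell 0 of integer array 1. *)
Definition accepts (R : realType) (s : store R) : bool := imem s 1 0 != 0%N.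

(** * gamma-ANN under the l_p norm

    The rows of [A] are the data points.  The preprocessing program sees only
    the data points; the query program starts from the memory left by the
    preprocessing, in which the query point x has been written in real array 1
    and gamma, r in real array 2. *)

Definition ann_query (R : realType) (d : nat) (s : store R) (gamma r : R)
    (x : 'rV[R]_d) : store R :=
  load (load s 1 (flat x)) 2 [:: gamma; r].

Definition ann_yes (R : realType) (p : \bar R) (N d : nat) (A : 'M[R]_(N, d))
    (r : R) (x : 'rV[R]_d) : Prop :=
  exists i, lp_norm p (row i A - x) <= r.

Definition ann_no (R : realType) (p : \bar R) (gamma : R) (N d : nat)
    (A : 'M[R]_(N, d)) (r : R) (x : 'rV[R]_d) : Prop :=
  forall i, gamma * r <= lp_norm p (row i A - x).

(* There is a (deterministic) algorithm for gamma-ANN, on inputs whose ambient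
   dimension satisfies [D], with preprocessing time N^C and query time
   N^(1 - delta), up to a factor poly(d).  The time bounds hold on all inputs,
   correctness is required under the promise only. *)
Definition has_ann_algorithm (R : realType) (p : \bar R) (D : nat -> Prop)
    (gamma C delta : R) : Prop :=
  exists (pre qry : cmd) (K : R) (k : nat),
  forall (N d : nat) (A : 'M[R]_(N, d)),
    (0 < N)%N -> (0 < d)%N -> D d -> injective (fun i => row i A) ->
  exists (t1 : nat) (s1 : store R),
    [/\ exec p pre (matrix_store A) t1 s1,
        t1%:R <= K * d%:R ^+ k * N%:R `^ C &
        forall (r : R) (x : 'rV[R]_d), 0 < r ->
        exists (t2 : nat) (s2 : store R),
          [/\ exec p qry (ann_query s1 gamma r x) t2 s2,
              t2%:R <= K * d%:R ^+ k * N%:R `^ (1 - delta),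
              ann_yes p A r x -> accepts s2 &
              ann_no p gamma A r x -> ~~ accepts s2]].

(** * gamma-SVP_p^{0,1}

    The rows of [B] are the basis vectors b_1, ..., b_n. *)

Definition latvec (R : realType) (n d : nat) (B : 'M[R]_(n, d))
    (alpha : 'rV[int]_n) : 'rV[R]_d :=
  \sum_i (alpha 0 i)%:~R *: row i B.

Definition svp_yes (R : realType) (p : \bar R) (n d : nat) (B : 'M[R]_(n, d))
    (r : R) : Prop :=
  exists alpha : 'rV[int]_n,
    [/\ alpha != 0, forall i, alpha 0 i = 0 \/ alpha 0 i = 1 &
        lp_norm p (latvec B alpha) <= r].

Definition svp_no (R : realType) (p : \bar R) (gamma : R) (n d : nat)
    (B : 'M[R]_(n, d)) (r : R) : Prop :=
  forall alpha : 'rV[int]_n,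
    alpha != 0 -> gamma * r <= lp_norm p (latvec B alpha).

(* There is a (deterministic) algorithm for gamma-SVP_p^{0,1}, on inputs whose
   ambient dimension satisfies [D], running in time 2^((1 - delta) n), up to a
   factor poly(d). *)
Definition has_svp_algorithm (R : realType) (p : \bar R) (D : nat -> Prop)
    (gamma delta : R) : Prop :=
  exists (prog : cmd) (K : R) (k : nat),
  forall (n d : nat) (B : 'M[R]_(n, d)) (r : R),
    (0 < d)%N -> D d -> row_free B -> 0 < r ->
  exists (t : nat) (s : store R),
    [/\ exec p prog (load (matrix_store B) 2 [:: gamma; r]) t s,
        t%:R <= K * d%:R ^+ k * 2 `^ ((1 - delta) * n%:R),
        svp_yes p B r -> accepts s &
        svp_no p gamma B r -> ~~ accepts s].

(* Main.v *)
(** Let m be the least integer above C + delta and n1 = n / m.  The data points are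
    the 2^n1 sums of subsets of the first n1 basis vectors.  The queries are the
    vectors -(b_i + u), where i < n is arbitrary and u is the sum of a subset of
    the last n - n1 basis vectors.  A data point minus a query is an integer
    combination with nonnegative coefficients, nonzero because of b_i, so a NO
    instance gives only NO queries; and every nonzero vector of {0,1}^n arises this
    way, by choosing i in its support.  The cost is (2^n1)^C for the preprocessing
    and about n 2^(n - n1) (2^n1)^(1 - delta) for the queries, and both are
    2^((1 - delta / m) n) up to poly(d).  A query time N^(1 - delta) with delta > 1
    is impossible for large N, hence m <= C + 2 and
    delta / m >= (C0 - 1) / (C0 + 2) * delta / (C - 1).

    A query may destroy the memory left by the preprocessing, which is too large to
    be copied before each query.  It is therefore run on a versioned memory: every
    simulated cell has a base value, a current value, and a stamp telling in which
    query the current value was written.  The choice between the two values is made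
    by address arithmetic, so that expressions are translated to expressions. *)

Require Import Defs.
From HB Require Import structures.
From mathcomp Require Import all_boot all_order all_algebra.
From mathcomp Require Import reals ereal exp.
From mathcomp Require Import boolp zify ring lra.

Set Implicit Arguments.
Unset Strict Implicit.
Unset Printing Implicit Defensive.

Import Order.TTheory GRing.Theory Num.Theory.
Local Open Scope ring_scope.

(** * Updating one memory cell *)

Lemma upd_eq (T : Type) (m : nat -> nat -> T) (a i : nat) (v : T) :
  upd m a i v a i = v.
Proof. by rewrite /upd !eqxx. Qed.

Lemma upd_neq (T : Type) (m : nat -> nat -> T) (a i : nat) (v : T) (a' i' : nat) :
  ~~ ((a' == a) && (i' == i)) -> upd m a i v a' i' = m a' i'.
Proof. by rewrite /upd => /negbTE ->. Qed.

Lemma upd_neq_array (T : Type) (m : nat -> nat -> T) (a i : nat) (v : T) (a' i' : nat) :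
  a' != a -> upd m a i v a' i' = m a' i'.
Proof. by move=> h; rewrite upd_neq // (negbTE h). Qed.

(** * Running a program on a versioned copy of the memory *)

Definition ivar (v : nat) : iexp := IGet 2 (INum v).
Definition iassign (v : nat) (e : iexp) : cmd := ISet 2 (INum v) e.

(* Physical integer arrays 0, 1 and 2 hold the input, the answer and the scalar
   variables of the host program; physical real arrays 0 to 2 also belong to the
   host.  Scalar 0 is scratch, scalar 1 is the current version q, scalar 2 is the
   stamp w put on written cells. *)
Definition int_array (a : nat) : nat := (3 * a + 3)%N.
Definition int_stamp (a : nat) : nat := (3 * a + 4)%N.
Definition real_stamp (a : nat) : nat := (3 * a + 5)%N.
Definition real_array (a : nat) : nat := (a + 3)%N.

(* Cell i of a simulated array is stored at 2i, or at 2i + 1 once its stamp t has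
   caught up with the current version q. *)
Definition slot (q t i : nat) : nat := (i + i + (1 - (q - t)))%N.

Definition slot_exp (t i : iexp) : iexp :=
  IAdd (IAdd i i) (ISub (INum 1) (ISub (ivar 1) t)).

Fixpoint sim_iexp (e : iexp) : iexp :=
  match e with
  | INum n => INum n
  | IGet a e1 =>
      IGet (int_array a) (slot_exp (IGet (int_stamp a) (sim_iexp e1)) (sim_iexp e1))
  | IAdd e1 e2 => IAdd (sim_iexp e1) (sim_iexp e2)
  | ISub e1 e2 => ISub (sim_iexp e1) (sim_iexp e2)
  end.

Fixpoint sim_rexp (e : rexp) : rexp :=
  match e with
  | RNat e1 => RNat (sim_iexp e1)
  | RGet a e1 =>
      RGet (real_array a) (slot_exp (IGet (real_stamp a) (sim_iexp e1)) (sim_iexp e1))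
  | RAdd e1 e2 => RAdd (sim_rexp e1) (sim_rexp e2)
  | ROpp e1 => ROpp (sim_rexp e1)
  | RMul e1 e2 => RMul (sim_rexp e1) (sim_rexp e2)
  | RInv e1 => RInv (sim_rexp e1)
  | RPow e1 => RPow (sim_rexp e1)
  end.

Fixpoint sim_bexp (e : bexp) : bexp :=
  match e with
  | ILe e1 e2 => ILe (sim_iexp e1) (sim_iexp e2)
  | RLe e1 e2 => RLe (sim_rexp e1) (sim_rexp e2)
  | BNot e1 => BNot (sim_bexp e1)
  | BAnd e1 e2 => BAnd (sim_bexp e1) (sim_bexp e2)
  end.

(** An assignment first saves its index in scratch, because writing the value may change what the
    index expression evaluates to. The value goes to the slot that becomes visible once the cell is
    stamped with [w]. *)
Fixpoint sim_cmd (c : cmd) : cmd :=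
  match c with
  | Skip => Skip
  | ISet a i e =>
      Seq (iassign 0 (sim_iexp i))
        (Seq (ISet (int_array a) (slot_exp (ivar 2) (ivar 0)) (sim_iexp e))
          (ISet (int_stamp a) (ivar 0) (ivar 2)))
  | RSet a i e =>
      Seq (iassign 0 (sim_iexp i))
        (Seq (RSet (real_array a) (slot_exp (ivar 2) (ivar 0)) (sim_rexp e))
          (ISet (real_stamp a) (ivar 0) (ivar 2)))
  | Seq c1 c2 => Seq (sim_cmd c1) (sim_cmd c2)
  | If b c1 c2 => If (sim_bexp b) (sim_cmd c1) (sim_cmd c2)
  | While b c1 => While (sim_bexp b) (sim_cmd c1)
  end.

Section Simulation.
Variables (R : realType) (p : \bar R).
Implicit Types (s ph : store R).

Definition simulates s ph : Prop :=
  (forall a i, imem s a i =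
     imem ph (int_array a) (slot (imem ph 2 1) (imem ph (int_stamp a) i) i)) /\
  (forall a i, rmem s a i =
     rmem ph (real_array a) (slot (imem ph 2 1) (imem ph (real_stamp a) i) i)).

(** What a simulated run leaves alone. Base values are protected only when stamp and version agree,
    as in a query; the preprocessing is meant to overwrite them. *)
Record sim_frame ph ph' : Prop := SimFrame {
  frame_int : forall a i, (a < 3)%N -> ~~ ((a == 2) && (i == 0))%N ->
    imem ph' a i = imem ph a i;
  frame_real : forall a i, (a < 3)%N -> rmem ph' a i = rmem ph a i;
  frame_int_stamp : forall a i,
    imem ph' (int_stamp a) i = imem ph (int_stamp a) i \/
    imem ph' (int_stamp a) i = imem ph 2 2;
  frame_real_stamp : forall a i,
    imem ph' (real_stamp a) i = imem ph (real_stamp a) i \/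
    imem ph' (real_stamp a) i = imem ph 2 2;
  frame_int_base : imem ph 2 1 = imem ph 2 2 -> forall a i,
    imem ph' (int_array a) (i + i)%N = imem ph (int_array a) (i + i)%N;
  frame_real_base : imem ph 2 1 = imem ph 2 2 -> forall a i,
    rmem ph' (real_array a) (i + i)%N = rmem ph (real_array a) (i + i)%N
}.

Lemma sim_frame_refl ph : sim_frame ph ph.
Proof. by split=> // *; left. Qed.

Lemma sim_frame_trans ph1 ph2 ph3 :
  sim_frame ph1 ph2 -> sim_frame ph2 ph3 -> sim_frame ph1 ph3.
Proof.
move=> [i1 r1 si1 sr1 bi1 br1] [i2 r2 si2 sr2 bi2 br2].
have e1 : imem ph2 2 1 = imem ph1 2 1 by rewrite i1.
have e2 : imem ph2 2 2 = imem ph1 2 2 by rewrite i1.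
rewrite e1 e2 in si2 sr2 bi2 br2.
split.
- by move=> a i ha hi; rewrite i2 // i1.
- by move=> a i ha; rewrite r2 // r1.
- by move=> a i; case: (si2 a i) => ->; [exact: si1|right].
- by move=> a i; case: (sr2 a i) => ->; [exact: sr1|right].
- by move=> h a i; rewrite bi2 // bi1.
- by move=> h a i; rewrite br2 // br1.
Qed.

Lemma sim_iexpE s ph (e : iexp) : simulates s ph -> ieval ph (sim_iexp e) = ieval s e.
Proof. by move=> [hi _]; elim: e => //= [a e ->|e1 -> e2 ->|e1 -> e2 ->]; rewrite ?hi. Qed.

Lemma sim_rexpE s ph (e : rexp) :
  simulates s ph -> reval p ph (sim_rexp e) = reval p s e.
Proof.
move=> h; elim: e => //= [e|a e|e1 -> e2 ->|e1 ->|e1 -> e2 ->|e1 ->|e1 ->] //;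
  rewrite !(sim_iexpE _ h) //.
by rewrite h.2.
Qed.

Lemma sim_bexpE s ph (e : bexp) :
  simulates s ph -> beval p ph (sim_bexp e) = beval p s e.
Proof.
move=> h; elim: e => //= [e1 e2|e1 e2|e1 ->|e1 -> e2 ->] //.
  by rewrite !(sim_iexpE _ h).
by rewrite !(sim_rexpE _ h).
Qed.

Lemma simulates_scratch s ph x : simulates s ph -> simulates s (iset ph 2 0 x).
Proof.
move=> [hi hr]; split=> a i /=; rewrite ?(hi, hr) !upd_neq //;
  rewrite /int_array /int_stamp /real_stamp; lia.
Qed.

(** Induction on the execution. A test remains one step and an assignment becomes three, whence the
    factor 3. *)
Lemma sim_cmdP (c : cmd) s t s' : exec p c s t s' ->
  forall ph, simulates s ph ->
  exists t' ph', [/\ exec p (sim_cmd c) ph t' ph', (t' <= 3 * t)%N,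
                     simulates s' ph' & sim_frame ph ph'].
Proof.
elim=> {c s t s'}.
- by move=> s ph h; exists 1%N, ph; split=> //; [exact: ExecSkip|exact: sim_frame_refl].
- move=> s a i e ph h.
  set ix := ieval s i; set v := ieval s e.
  have h1 := simulates_scratch ix h.
  set ph1 := iset ph 2 0 ix in h1.
  set w := imem ph 2 2; set q := imem ph 2 1.
  set ph2 := iset ph1 (int_array a) (slot q w ix) v.
  exists (1 + (1 + 1))%N, (iset ph2 (int_stamp a) ix w); split=> //.
  + apply: (@ExecSeq _ _ _ _ _ ph1).
      by rewrite /ph1 /ix -(sim_iexpE i h); exact: ExecISet.
    apply: (@ExecSeq _ _ _ _ _ ph2).
      by rewrite /ph2 /v -(sim_iexpE e h1); exact: ExecISet.
    have e0 : ieval ph2 (ivar 0) = ix.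
      by rewrite [LHS]upd_neq_array; [exact: upd_eq|rewrite /int_array; lia].
    have e2 : ieval ph2 (ivar 2) = w.
      by rewrite [LHS]upd_neq_array; [exact: upd_neq|rewrite /int_array; lia].
    rewrite -e0 -e2.
    exact: ExecISet.
  + case: h => hi hr; split=> a' i' /=.
      have -> : upd (imem ph2) (int_stamp a) ix w 2 1 = q.
        by rewrite upd_neq ?[LHS]upd_neq //= /int_stamp /int_array; lia.
      have [/andP[/eqP -> /eqP ->]|hn] := boolP ((a' == a) && (i' == ix)).
        rewrite !upd_eq [RHS]upd_neq_array ?[RHS]upd_eq //.
        by rewrite /int_array /int_stamp; lia.
      have -> : upd (imem s) a ix v a' i' = imem s a' i' by rewrite upd_neq.
      rewrite hi -/q.
      have -> : upd (imem ph2) (int_stamp a) ix w (int_stamp a') i' = imem ph (int_stamp a') i'.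
        rewrite upd_neq ?[LHS]upd_neq ?upd_neq //= /int_stamp /int_array;
        by move: hn; lia.
      (* Index [i] owns the slots [2i] and [2i + 1], so distinct simulated cells never collide. *)
      rewrite [RHS]upd_neq ?[RHS]upd_neq ?upd_neq //= /int_stamp /int_array /slot;
        by move: hn; lia.
    rewrite hr -/q.
    have -> : upd (imem ph2) (int_stamp a) ix w 2 1 = q.
      by rewrite upd_neq ?[LHS]upd_neq //= /int_stamp /int_array; lia.
    by rewrite upd_neq ?[upd _ (int_array a) _ _ _ _]upd_neq ?upd_neq //=
      /int_stamp /int_array /real_stamp; lia.
  + split=> //=.
    * move=> a' i' ha hn; rewrite !upd_neq //; rewrite /int_stamp /int_array; lia.
    * move=> a' i'.
      have [/andP[/eqP -> /eqP ->]|hn] := boolP ((a' == a) && (i' == ix)).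
        by right; rewrite upd_eq.
      left; rewrite !upd_neq //; rewrite /int_stamp /int_array; lia.
    * move=> a' i'; left; rewrite !upd_neq //; rewrite /int_stamp /int_array /real_stamp; lia.
    (* With [q = w] the written slot is odd, hence not a base slot. *)
    * rewrite -/q -/w => qw a' i'; rewrite !upd_neq //; rewrite /int_stamp /int_array /slot; lia.
- move=> s a i e ph h.
  set ix := ieval s i; set v := reval p s e.
  have h1 := simulates_scratch ix h.
  set ph1 := iset ph 2 0 ix in h1.
  set w := imem ph 2 2; set q := imem ph 2 1.
  set ph2 := rset ph1 (real_array a) (slot q w ix) v.
  exists (1 + (1 + 1))%N, (iset ph2 (real_stamp a) ix w); split=> //.
  + apply: (@ExecSeq _ _ _ _ _ ph1).
      by rewrite /ph1 /ix -(sim_iexpE i h); exact: ExecISet.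
    apply: (@ExecSeq _ _ _ _ _ ph2).
      by rewrite /ph2 /v -(sim_rexpE e h1); exact: ExecRSet.
    exact: ExecISet.
  + case: h => hi hr; split=> a' i' /=.
      rewrite hi -/q !upd_neq //; rewrite /int_stamp /int_array /real_stamp; lia.
    have -> : upd (upd (imem ph) 2 0 ix) (real_stamp a) ix w 2 1 = q.
      by rewrite !upd_neq //= /real_stamp; lia.
    have [/andP[/eqP -> /eqP ->]|hn] := boolP ((a' == a) && (i' == ix)).
      by rewrite !upd_eq.
    rewrite upd_neq // hr -/q.
    rewrite ![upd _ (real_stamp _) _ _ _ _]upd_neq; last by rewrite /real_stamp; lia.
    rewrite [upd _ 2 _ _ _ _]upd_neq; last by rewrite /real_stamp; lia.
    rewrite upd_neq //; rewrite /real_array /slot; lia.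
  + split=> //=.
    * move=> a' i' ha hn; rewrite !upd_neq //; rewrite /real_stamp; lia.
    * move=> a' i' ha; rewrite !upd_neq //; rewrite /real_array; lia.
    * move=> a' i'; left; rewrite !upd_neq //; rewrite /int_stamp /real_stamp; lia.
    * move=> a' i'.
      have [/andP[/eqP -> /eqP ->]|hn] := boolP ((a' == a) && (i' == ix)).
        by right; rewrite upd_eq.
      left; rewrite !upd_neq //; rewrite /real_stamp; lia.
    * move=> _ a' i'; rewrite !upd_neq //; rewrite /int_array /real_stamp; lia.
    * rewrite -/q -/w => qw a' i'; rewrite !upd_neq //; rewrite /real_array /slot; lia.
- move=> c1 c2 s1 s2 s3 t1 t2 _ IH1 _ IH2 ph h.
  have [t1' [ph1 [e1 b1 h1 f1]]] := IH1 _ h.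
  have [t2' [ph2 [e2 b2 h2 f2]]] := IH2 _ h1.
  exists (t1' + t2')%N, ph2; split=> //; first exact: ExecSeq e1 e2.
    lia.
  exact: sim_frame_trans f1 f2.
- move=> b c1 c2 s s' t hb _ IH ph h; have [t' [ph' [e ht h' f]]] := IH _ h.
  exists t'.+1, ph'; split=> //; last lia.
  by apply: ExecIfTrue e; rewrite (sim_bexpE _ h).
- move=> b c1 c2 s s' t hb _ IH ph h; have [t' [ph' [e ht h' f]]] := IH _ h.
  exists t'.+1, ph'; split=> //; last lia.
  by apply: ExecIfFalse e; rewrite (sim_bexpE _ h).
- move=> b c s hb ph h; exists 1%N, ph; split=> //; last exact: sim_frame_refl.
  by apply: ExecWhileFalse; rewrite (sim_bexpE _ h).
- move=> b c s1 s2 s3 t1 t2 hb _ IH1 _ IH2 ph h.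
  have [t1' [ph1 [e1 b1 h1 f1]]] := IH1 _ h.
  have [t2' [ph2 [e2 b2 h2 f2]]] := IH2 _ h1.
  exists (t1' + t2').+1, ph2; split=> //; last exact: sim_frame_trans f1 f2.
    by apply: ExecWhileTrue e1 e2; rewrite (sim_bexpE _ h).
  lia.
Qed.

End Simulation.

(** * Bounded runs *)

Section Runs.
Variables (R : realType) (p : \bar R).
Implicit Types (s : store R) (P Q : store R -> Prop).

Definition run (c : cmd) s (T : nat) P : Prop :=
  exists t s', [/\ exec p c s t s', (t <= T)%N & P s'].

Lemma run_weaken (c : cmd) s T T' P P' :
  run c s T P -> (T <= T')%N -> (forall s', P s' -> P' s') -> run c s T' P'.
Proof.
move=> [t [s' [e h hP]]] hT hPP; exists t, s'; split=> //; last exact: hPP.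
exact: leq_trans hT.
Qed.

Lemma run_skip s T P : (0 < T)%N -> P s -> run Skip s T P.
Proof. by move=> hT hP; exists 1%N, s; split=> //; exact: ExecSkip. Qed.

Lemma run_iset s a i e T P :
  (0 < T)%N -> P (iset s a (ieval s i) (ieval s e)) -> run (ISet a i e) s T P.
Proof. by move=> hT hP; eexists _, _; split; [exact: ExecISet| |exact: hP]. Qed.

Lemma run_rset s a i e T P :
  (0 < T)%N -> P (rset s a (ieval s i) (reval p s e)) -> run (RSet a i e) s T P.
Proof. by move=> hT hP; eexists _, _; split; [exact: ExecRSet| |exact: hP]. Qed.

Lemma run_seq c1 c2 s T1 T2 T P Q :
  run c1 s T1 Q -> (forall s', Q s' -> run c2 s' T2 P) -> (T1 + T2 <= T)%N ->
  run (Seq c1 c2) s T P.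
Proof.
move=> [t1 [s1 [e1 h1 /[swap] h q]]] hT; have [t2 [s2 [e2 h2 hP]]] := h _ q.
exists (t1 + t2)%N, s2; split=> //; first exact: ExecSeq e1 e2.
lia.
Qed.

Lemma run_iset_seq s a i e c T P :
  run c (iset s a (ieval s i) (ieval s e)) T P -> run (Seq (ISet a i e) c) s T.+1 P.
Proof.
move=> h; apply: (@run_seq _ _ _ 1 T T.+1 _
  (fun s' => s' = iset s a (ieval s i) (ieval s e))) => //.
- exact: run_iset.
- by move=> _ ->.
Qed.

Lemma run_rset_seq s a i e c T P :
  run c (rset s a (ieval s i) (reval p s e)) T P -> run (Seq (RSet a i e) c) s T.+1 P.
Proof.
move=> h; apply: (@run_seq _ _ _ 1 T T.+1 _
  (fun s' => s' = rset s a (ieval s i) (reval p s e))) => //.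
- exact: run_rset.
- by move=> _ ->.
Qed.

Lemma run_if s b c1 c2 T P :
  (beval p s b -> run c1 s T P) -> (~~ beval p s b -> run c2 s T P) ->
  run (If b c1 c2) s T.+1 P.
Proof.
move=> h1 h2; case: (boolP (beval p s b)) => hb.
  have [t [s' [e ht hP]]] := h1 hb; exists t.+1, s'; split=> //; exact: ExecIfTrue.
have [t [s' [e ht hP]]] := h2 hb; exists t.+1, s'; split=> //; exact: ExecIfFalse.
Qed.

(** [Inv k] describes the state after [k] rounds. Each round pays one extra step for its test, and
    the final failing test pays one more. *)
Lemma run_while b c (Inv : nat -> store R -> Prop) (m T : nat) s :
  Inv 0%N s ->
  (forall k s', (k < m)%N -> Inv k s' -> beval p s' b /\ run c s' T (Inv k.+1)) ->
  (forall s', Inv m s' -> ~~ beval p s' b) ->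
  run (While b c) s (m * T.+1).+1 (Inv m).
Proof.
move=> h0 hS hE.
suff H l k s' : (k + l = m)%N -> Inv k s' -> run (While b c) s' (l * T.+1).+1 (Inv m).
  exact: (H m 0%N).
elim: l k s' => [|l IH] k s' hk hI.
  have hm : k = m by lia.
  subst k; exists 1%N, s'; split=> //.
  by apply: ExecWhileFalse; exact: hE.
have hkm : (k < m)%N by lia.
have [hb [t1 [s1 [e1 h1 hI1]]]] := hS k s' hkm hI.
have hk1 : (k.+1 + l = m)%N by lia.
have [t2 [s2 [e2 h2 hI2]]] := IH k.+1 s1 hk1 hI1.
exists (t1 + t2).+1, s2; split=> //; first exact: ExecWhileTrue e1 e2.
rewrite mulSn; lia.
Qed.

(** This is what later forces [delta <= 1]: no query takes less than one step. *)
Lemma exec_gt0 (c : cmd) s t s' : exec p c s t s' -> (0 < t)%N.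
Proof. by elim=> //; lia. Qed.

End Runs.

(** * Tables of vectors *)

Section Tables.
Variables (R : realType) (d : nat).
Implicit Types (vs : seq 'rV[R]_d) (v b : 'rV[R]_d).

Definition cells vs : seq R := flatten [seq flat v | v <- vs].

(** Appending the translates by [b] doubles the table; iterating over basis rows yields all subset
    sums at one vector addition each. *)
Definition grow vs b : seq 'rV[R]_d := vs ++ [seq v + b | v <- vs].

Lemma flat_row v : flat v = [seq v 0 j | j <- enum 'I_d].
Proof.
have -> : flat v = flatten [seq [seq v i j | j <- enum 'I_d] | i <- enum 'I_1] by [].
have -> : enum 'I_1 = [:: 0] by apply: (inj_map val_inj); rewrite val_enum_ord.
by rewrite /= cats0.
Qed.

Lemma size_flat m (A : 'M[R]_(m, d)) : size (flat A) = (m * d)%N.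
Proof. by rewrite size_allpairs !size_enum_ord. Qed.

Lemma size_flat_row v : size (flat v) = d.
Proof. by rewrite size_flat mul1n. Qed.

Lemma nth_flat_row v (j : 'I_d) : nth 0 (flat v) j = v 0 j.
Proof. by rewrite flat_row (nth_map j) ?size_enum_ord // nth_ord_enum. Qed.

Lemma nth_flat_rowD v b j :
  nth 0 (flat (v + b)) j = nth 0 (flat v) j + nth 0 (flat b) j.
Proof.
have [hj|hj] := ltnP j d; last by rewrite !nth_default ?size_flat_row ?addr0.
by rewrite -[j]/(nat_of_ord (Ordinal hj)) !nth_flat_row mxE.
Qed.

Lemma nth_flat_rowN v j : nth 0 (flat (- v)) j = - nth 0 (flat v) j.
Proof.
have [hj|hj] := ltnP j d; last by rewrite !nth_default ?size_flat_row ?oppr0.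
by rewrite -[j]/(nat_of_ord (Ordinal hj)) !nth_flat_row mxE.
Qed.

Lemma size_cells vs : size (cells vs) = (size vs * d)%N.
Proof.
by elim: vs => //= v vs; rewrite /cells /= size_cat size_flat_row mulSn => ->.
Qed.

Lemma nth_cells vs t j : (j < d)%N ->
  nth 0 (cells vs) (t * d + j) = nth 0 (flat (nth 0 vs t)) j.
Proof.
move=> hj; elim: vs t => [|v vs IH] [|t] /=.
- by rewrite nth_nil -[j]/(nat_of_ord (Ordinal hj)) nth_flat_row mxE.
- by rewrite nth_nil -[j]/(nat_of_ord (Ordinal hj)) nth_flat_row mxE.
- by rewrite /cells /= nth_cat size_flat_row mul0n add0n hj.
- rewrite /cells /= nth_cat size_flat_row mulSn -addnA ltnNge leq_addr /=.
  by rewrite addKn IH.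
Qed.

Lemma flat_cells m (A : 'M[R]_(m, d)) : flat A = cells [seq row i A | i <- enum 'I_m].
Proof.
rewrite /cells -map_comp.
have -> : flat A = flatten [seq [seq A i j | j <- enum 'I_d] | i <- enum 'I_m] by [].
congr flatten; apply: eq_map => i /=; rewrite flat_row.
by apply: eq_map => j; rewrite mxE.
Qed.

Definition vecs_mx vs : 'M[R]_(size vs, d) := \matrix_(i < size vs) nth 0 vs i.

Lemma row_vecs_mx vs i : row i (vecs_mx vs) = nth 0 vs i.
Proof. by rewrite rowK. Qed.

Lemma flat_vecs_mx vs : flat (vecs_mx vs) = cells vs.
Proof.
rewrite flat_cells; congr cells.
under eq_map => i do rewrite row_vecs_mx.
by rewrite (map_comp (nth 0 vs) val) val_enum_ord -/(mkseq _ _) mkseq_nth.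
Qed.

(* The contents of the table after k cells of the second half of [grow vs b]. *)
Definition half_grown vs b (k : nat) : seq R :=
  cells vs ++ [seq nth 0 (cells vs) i + nth 0 (flat b) (i %% d) | i <- iota 0 k].

Lemma size_half_grown vs b k : size (half_grown vs b k) = (size vs * d + k)%N.
Proof. by rewrite size_cat size_cells size_map size_iota. Qed.

Lemma half_grown0 vs b : half_grown vs b 0 = cells vs.
Proof. by rewrite /half_grown cats0. Qed.

Lemma half_grownS vs b k : half_grown vs b k.+1 =
  rcons (half_grown vs b k) (nth 0 (cells vs) k + nth 0 (flat b) (k %% d)).
Proof. by rewrite /half_grown -[k.+1]addn1 iotaD map_cat rcons_cat cats1. Qed.

Lemma nth_half_grown vs b k i : (i < size vs * d)%N ->
  nth 0 (half_grown vs b k) i = nth 0 (cells vs) i.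
Proof. by move=> hi; rewrite nth_cat size_cells hi. Qed.

Lemma half_grown_full vs b : (0 < d)%N ->
  half_grown vs b (size vs * d) = cells (grow vs b).
Proof.
move=> d0; rewrite /half_grown /grow.
have cells_cat us ws : cells (us ++ ws) = cells us ++ cells ws.
  by rewrite /cells map_cat flatten_cat.
rewrite cells_cat; congr (_ ++ _).
apply: (@eq_from_nth _ 0).
  by rewrite size_map size_iota size_cells size_map.
move=> k; rewrite size_map size_iota => hk.
rewrite (nth_map 0%N) ?size_iota // nth_iota // add0n.
rewrite {1 3}(divn_eq k d) !nth_cells ?ltn_mod //.
rewrite (nth_map 0); last by rewrite ltn_divLR.
by rewrite nth_flat_rowD.
Qed.

Lemma size_grow vs b : size (grow vs b) = (2 * size vs)%N.
Proof. by rewrite size_cat size_map mul2n addnn. Qed.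

End Tables.

(** * Splitting the lattice vectors *)

Section Lattice.
Variables (R : realType) (n d : nat) (B : 'M[R]_(n, d)).
Implicit Types (vs : seq 'rV[R]_d) (al be : 'rV[int]_n).

Definition basis_seq : seq 'rV[R]_d := [seq row i B | i <- enum 'I_n].

Lemma size_basis_seq : size basis_seq = n.
Proof. by rewrite size_map size_enum_ord. Qed.

Lemma nth_basis_seq (i : 'I_n) : nth 0 basis_seq i = row i B.
Proof. by rewrite (nth_map i) ?size_enum_ord // nth_ord_enum. Qed.

(** The sums of a member of [vs] and a subset of the rows [a], ..., [a + k - 1]. Starting from
    [[:: 0]] gives the data points; starting from the basis gives the negated queries. *)
Fixpoint grown vs (a k : nat) : seq 'rV[R]_d :=
  if k is k'.+1 then grow (grown vs a k') (nth 0 basis_seq (a + k')) else vs.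

Lemma size_grown vs a k : size (grown vs a k) = (size vs * 2 ^ k)%N.
Proof. by elim: k => [|k IH] /=; rewrite ?muln1 // size_grow IH expnS mulnCA. Qed.

Definition binary al : Prop := forall i, al 0 i = 0 \/ al 0 i = 1.

Definition supported al (a b : nat) : Prop :=
  forall i : 'I_n, ~~ (a <= i < b)%N -> al 0 i = 0.

Lemma latvecE al : latvec B al = map_mx intr al *m B.
Proof. by rewrite mulmx_sum_row; apply: eq_bigr => i _; rewrite mxE. Qed.

Lemma latvecD al be : latvec B (al + be) = latvec B al + latvec B be.
Proof. by rewrite !latvecE map_mxD mulmxDl. Qed.

Lemma latvec0 : latvec B 0 = 0.
Proof. by rewrite latvecE map_mx0 mul0mx. Qed.

Lemma latvec_delta (i : 'I_n) : latvec B (delta_mx 0 i) = row i B.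
Proof. by rewrite latvecE map_delta_mx -rowE. Qed.

Lemma latvec_inj : row_free B -> injective (latvec B).
Proof.
move=> fB al be; rewrite !latvecE => /(row_free_inj fB) h.
apply/rowP => i; have /rowP /(_ i) := h; rewrite !mxE.
exact: intr_inj.
Qed.

(** By induction on [k]: the coefficient of the last row, 0 or 1, says whether the vector lies in
    the old half of the table or in its translate. *)
Lemma grown_complete vs u be a k : (a + k <= n)%N -> u \in vs -> binary be ->
  supported be a (a + k) -> u + latvec B be \in grown vs a k.
Proof.
move=> hn hu; elim: k be hn => [|k IH] be hn hb hs /=.
  have -> : be = 0 by apply/rowP => i; rewrite mxE hs //; lia.
  by rewrite latvec0 addr0.
have hk : (a + k < n)%N by lia.
pose o := Ordinal hk.
have hak : (a + k <= n)%N by lia.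
rewrite mem_cat -[(a + k)%N]/(nat_of_ord o) nth_basis_seq.
case: (hb o) => hbo.
  apply/orP; left; apply: IH => // i hi; have [->//|hio] := eqVneq i o.
  by apply: hs; move/eqP: hio => hio; apply: contra hi => hi;
    have : nat_of_ord i <> nat_of_ord o by [move/val_inj|]; rewrite /=; lia.
apply/orP; right; apply/mapP; exists (u + latvec B (be - delta_mx 0 o)).
  apply: IH => //.
    move=> i; rewrite !mxE /=; have [->|_] := eqVneq i o; last by rewrite subr0; exact: hb.
    by rewrite hbo subrr; left.
  move=> i hi; rewrite !mxE /=; have [->|hio] := eqVneq i o; first by rewrite hbo subrr.
  rewrite subr0; apply: hs; move/eqP: hio => hio; apply: contra hi => hi.
  by have : nat_of_ord i <> nat_of_ord o by [move/val_inj|]; rewrite /=; lia.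
by rewrite -latvec_delta -addrA -latvecD subrK.
Qed.

Lemma grown_sound vs v a k : (a + k <= n)%N -> v \in grown vs a k ->
  exists u be, [/\ u \in vs, binary be, supported be a (a + k) &
                   v = u + latvec B be].
Proof.
elim: k v => [|k IH] v hn /=.
  move=> hv; exists v, 0; split=> //; last by rewrite latvec0 addr0.
    by move=> i; rewrite mxE; left.
  by move=> i; rewrite mxE.
have hk : (a + k < n)%N by lia.
pose o := Ordinal hk.
have hak : (a + k <= n)%N by lia.
rewrite mem_cat -[(a + k)%N]/(nat_of_ord o) nth_basis_seq => /orP[/(IH _ hak)|/mapP[v']].
  move=> [u [be [hu hb hs ->]]]; exists u, be; split=> // i hi; apply: hs; lia.
move=> /(IH _ hak) [u [be [hu hb hs ->]]] ->.
have beo : be 0 o = 0 by apply: hs; rewrite /=; lia.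
exists u, (be + delta_mx 0 o); split=> //.
- move=> i; rewrite !mxE /=; have [->|_] := eqVneq i o; first by rewrite beo add0r; right.
  by rewrite addr0.
- move=> i hi; rewrite !mxE /=; have [hio|_] := eqVneq i o.
    by move: hi; rewrite hio /=; lia.
  by rewrite addr0; apply: hs; lia.
- by rewrite latvecD latvec_delta addrA.
Qed.

(** The data points of an ANN instance must be distinct. A collision between the two halves would,
    by linear independence, equate two coefficient vectors of which one has 0 and the other 1 at
    position [k]. *)
Lemma uniq_grown k : row_free B -> (k <= n)%N -> uniq (grown [:: 0] 0 k).
Proof.
move=> fB; elim: k => [//|k IH] hk /=.
rewrite cat_uniq IH ?(ltnW hk) //= map_inj_uniq ?IH ?(ltnW hk) //; last exact: addIr.
rewrite andbT; apply/hasPn => _ /mapP[v hv ->]; apply/negP => hw.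
have hak : (0 + k <= n)%N by lia.
have [_ [al [/[!inE]/eqP -> _ hal hal']]] := grown_sound hak hv.
have [_ [be [/[!inE]/eqP -> _ hbe hbe']]] := grown_sound hak hw.
pose o := Ordinal hk.
move: hbe'; rewrite hal' !add0r -[k]/(nat_of_ord o) nth_basis_seq -latvec_delta -latvecD.
move=> /(latvec_inj fB) /rowP /(_ o).
by rewrite !mxE (hal o) ?(hbe o) ?eqxx //= add0n ltnn.
Qed.

Lemma split_yes (p : \bar R) (r : R) (m : nat) : (m <= n)%N -> svp_yes p B r ->
  exists2 v, v \in grown basis_seq m (n - m) &
    ann_yes p (vecs_mx (grown [:: 0] 0 m)) r (- v).
Proof.
move=> hm [al [al0 hal hr]].
have [i hi] : exists i, al 0 i != 0.
  by apply/existsP; apply: contraR al0 => /existsPn h; apply/eqP/rowP => i;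
    rewrite mxE; apply/eqP; have := h i; rewrite negbK.
have ali : al 0 i = 1 by case: (hal i) => // ali; rewrite ali eqxx in hi.
(* Index [i] is removed from whichever half contains it, since the query contributes row [i]
   separately. *)
pose ga : 'rV[int]_n := \row_j (if (j < m)%N && (j != i) then al 0 j else 0).
pose be : 'rV[int]_n := \row_j (if (m <= j)%N && (j != i) then al 0 j else 0).
have hsplit : al = ga + (delta_mx 0 i + be).
  apply/rowP => j; rewrite !mxE /=; have [->|_] := eqVneq j i.
    by rewrite !andbF addr0 add0r ali.
  by rewrite !andbT ltnNge; case: (m <= j)%N; rewrite /= ?add0r ?addr0.
exists (row i B + latvec B be).
  apply: grown_complete; first by lia.
  - by apply: map_f; rewrite mem_enum.
  - by move=> j; rewrite mxE; case: ifP => _; [exact: hal|left].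
  - by move=> j hj; rewrite mxE; case: ifP => // /andP[hj' _]; have := ltn_ord j; lia.
have hg : 0 + latvec B ga \in grown [:: 0] 0 m.
  apply: grown_complete => //; first by rewrite inE.
  - by move=> j; rewrite mxE; case: ifP => _; [exact: hal|left].
  - by move=> j hj; rewrite mxE; case: ifP => // /andP[hj' _]; lia.
set u := 0 + latvec B ga in hg.
set us := grown [:: 0] 0 m in hg *.
have ix : (index u us < size us)%N.
  by rewrite index_mem.
exists (Ordinal ix); rewrite row_vecs_mx /= nth_index // /u add0r opprK.
by rewrite -latvec_delta -!latvecD -hsplit.
Qed.

(** The coefficient at [j] is at least 1, so the combination is nonzero. It may be 2, which is why
    the NO promise has to cover all integer vectors. *)
Lemma split_no (p : \bar R) (gamma r : R) (m : nat) v :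
  (m <= n)%N -> svp_no p gamma B r -> v \in grown basis_seq m (n - m) ->
  ann_no p gamma (vecs_mx (grown [:: 0] 0 m)) r (- v).
Proof.
move=> hm hno hv i; rewrite row_vecs_mx opprK.
have hmn : (m + (n - m) <= n)%N by lia.
have [_ [be [/mapP[j _ ->] hb _ ->]]] := grown_sound hmn hv.
have hi : nth 0 (grown [:: 0] 0 m) i \in grown [:: 0] 0 m by exact: mem_nth.
have [_ [ga [/[!inE]/eqP -> hg _ ->]]] := grown_sound (hm : (0 + m <= n)%N) hi.
rewrite add0r -latvec_delta -!latvecD; apply: hno.
apply/eqP => /rowP /(_ j); rewrite !mxE !eqxx.
by case: (hb j) => ->; case: (hg j) => ->.
Qed.

End Lattice.

(** * The program *)

Definition ilt (e1 e2 : iexp) : bexp := ILe (IAdd e1 (INum 1)) e2.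

(** With [b] true the table occupies the even cells, which are the base slots of a versioned array:
    the data points are produced directly as simulated input. *)
Definition stride (b : bool) (k : nat) : nat := if b then (k + k)%N else k.
Definition stride_exp (b : bool) (e : iexp) : iexp := if b then IAdd e e else e.

(* Scalars: 3 = number of rows generating the data points, 4 = remainder of the
   division computing it, 5 = number of data points, 6 = length of the current
   table, 7 = offset in the matrix or in the query table, 8 = current row,
   9 and 10 = loop counters. *)
Definition split_cmd (m : nat) : cmd :=
  Seq (iassign 4 (IGet 0 (INum 0)))
    (While (ILe (INum m) (ivar 4))
      (Seq (iassign 4 (ISub (ivar 4) (INum m)))
           (iassign 3 (IAdd (ivar 3) (INum 1))))).

(** Scalar 10 is scalar 9 modulo [d], maintained by resetting it, since the machine has no division
    of natural numbers. *)
Definition grow_step (arr : nat) (b : bool) : cmd :=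
  Seq (RSet arr (stride_exp b (IAdd (ivar 6) (ivar 9)))
         (RAdd (RGet arr (stride_exp b (ivar 9))) (RGet 0 (IAdd (ivar 7) (ivar 10)))))
  (Seq (iassign 9 (IAdd (ivar 9) (INum 1)))
  (Seq (iassign 10 (IAdd (ivar 10) (INum 1)))
  (If (ILe (IGet 0 (INum 1)) (ivar 10)) (iassign 10 (INum 0)) Skip))).

Definition grow_cmd (arr : nat) (b : bool) : cmd :=
  Seq (iassign 9 (INum 0))
  (Seq (iassign 10 (INum 0))
  (Seq (While (ilt (ivar 9) (ivar 6)) (grow_step arr b))
  (Seq (iassign 5 (IAdd (ivar 5) (ivar 5)))
  (Seq (iassign 6 (IAdd (ivar 6) (ivar 6)))
  (Seq (iassign 7 (IAdd (ivar 7) (IGet 0 (INum 1))))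
       (iassign 8 (IAdd (ivar 8) (INum 1)))))))).

Definition grow_all (arr : nat) (b : bool) (hi : iexp) : cmd :=
  While (ilt (ivar 8) hi) (grow_cmd arr b).

Section Program.
Variables (R : realType) (p : \bar R).
Implicit Types (s : store R).

(** As [nth] defaults to 0, this also says that the cells beyond the list are 0, as the input
    convention of the preprocessing demands. *)
Definition holds s (arr : nat) (b : bool) (l : seq R) : Prop :=
  forall k, rmem s arr (stride b k) = nth 0 l k.

Definition keep_ints (l : seq nat) s s' : Prop :=
  forall a i, ~~ ((a == 2%N) && (i \in l)) -> imem s' a i = imem s a i.

Lemma split_cmdP (m : nat) s : (0 < m)%N -> imem s 2 3 = 0%N ->
  run p (split_cmd m) s (3 * imem s 0 0 + 2)
    (fun s' => [/\ imem s' 2 3 = (imem s 0 0 %/ m)%N, keep_ints [:: 3; 4]%N s s' &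
                   rmem s' = rmem s]).
Proof.
move=> m0 h3; set n := imem s 0 0.
apply: (@run_weaken _ _ _ _ ((n %/ m) * 3).+2); last first.
- move=> s'; exact.
- by have := leq_div n m; lia.
apply: run_iset_seq.
pose Inv k s' := [/\ imem s' 2 3 = k, imem s' 2 4 = (n - k * m)%N,
  keep_ints [:: 3; 4]%N s s' & rmem s' = rmem s].
apply: run_weaken (@run_while _ p _ _ Inv (n %/ m) 2 _ _ _ _) _ _ => //.
- split=> //=; first by rewrite /upd /= mul0n subn0.
  by move=> a i hai; rewrite /= upd_neq //; apply: contra hai => /andP[-> /eqP ->].
- move=> k s' hk [i3 i4 hI hR].
  have hkm : (k.+1 * m <= n)%N.
    by apply: leq_trans (leq_trunc_div n m); rewrite leq_mul2r hk orbT.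
  split; first by rewrite /= i4; rewrite mulSn in hkm; lia.
  apply: run_iset_seq; apply: run_iset => //; split=> //=.
  + by rewrite /upd /= i3 addn1.
  + by rewrite /upd /= i4 mulSn subnDA subnAC.
  + move=> a i hai; rewrite /= !upd_neq ?hI //; apply: contra hai => /andP[-> /eqP ->];
    by rewrite !inE.
- move=> s' [_ /= -> _ _]; rewrite -ltnNge.
  by rewrite {1}(divn_eq n m) addKn ltn_mod.
- by move=> s' [].
Qed.

Lemma stride_inj b : injective (stride b).
Proof. by case: b => x y //=; rewrite /stride; lia. Qed.

Lemma stride_expE s b e : ieval s (stride_exp b e) = stride b (ieval s e).
Proof. by case: b. Qed.

Variables (n d : nat) (B : 'M[R]_(n, d)).
Hypothesis d_gt0 : (0 < d)%N.

(** Only the first [n * d] cells are constrained, because the query table grows in this very array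
    with the basis as its beginning. *)
Definition holds_basis s : Prop :=
  forall k, (k < n * d)%N -> rmem s 0 k = nth 0 (flat B) k.

Lemma nth_flat_basis (i : nat) j : (j < d)%N ->
  nth 0 (flat B) (i * d + j) = nth 0 (flat (nth 0 (basis_seq B) i)) j.
Proof. by move=> hj; rewrite flat_cells nth_cells. Qed.

Lemma modS_case k : (k.+1 %% d)%N =
  if (d <= (k %% d) + 1)%N then 0%N else ((k %% d) + 1)%N.
Proof.
have hk := ltn_mod k d; rewrite d_gt0 in hk.
have e : k.+1 = ((k %/ d) * d + (k %% d + 1))%N by rewrite addn1 addnS -divn_eq.
rewrite e modnMDl; case: leqP => h; last by rewrite modn_small.
have -> : (k %% d + 1 = d)%N by lia.
by rewrite modnn.
Qed.

(** The disjunction says that the table either lives apart from the matrix or extends it in place;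
    in the second case all writes land beyond the basis rows. *)
Lemma grow_loopP s arr b (vs : seq 'rV[R]_d) (i : nat) :
  holds s arr b (cells vs) -> holds_basis s ->
  (arr != 0%N) || (~~ b && (n <= size vs)%N) -> (i < n)%N ->
  imem s 0 1 = d -> imem s 2 6 = (size vs * d)%N -> imem s 2 7 = (i * d)%N ->
  imem s 2 9 = 0%N -> imem s 2 10 = 0%N ->
  run p (While (ilt (ivar 9) (ivar 6)) (grow_step arr b)) s (size vs * d * 6).+1
    (fun s' => [/\ holds s' arr b (cells (grow vs (nth 0 (basis_seq B) i))),
                   holds_basis s', keep_ints [:: 9; 10]%N s s' &
                   forall a x, a != arr -> rmem s' a x = rmem s a x]).
Proof.
move=> hT hB harr hi i01 i6 i7 i9 i10.
set v := nth 0 (basis_seq B) i.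
pose Inv k s' := [/\ imem s' 2 9 = k, imem s' 2 10 = (k %% d)%N &
  [/\ holds s' arr b (half_grown vs v k),
      holds_basis s', keep_ints [:: 9; 10]%N s s' &
      forall a x, a != arr -> rmem s' a x = rmem s a x]].
apply: run_weaken (@run_while _ p _ _ Inv (size vs * d) 5 _ _ _ _) _ _ => //.
- by split=> //; [rewrite mod0n|rewrite half_grown0].
- move=> k s' hk [h9 h10 [hT' hB' hI hR]].
  have h6 : imem s' 2 6 = (size vs * d)%N by rewrite hI.
  have h7 : imem s' 2 7 = (i * d)%N by rewrite hI.
  have h01 : imem s' 0 1 = d by rewrite hI.
  split; first by rewrite /= h9 h6 addn1.
  have hkd : (k %% d < d)%N by rewrite ltn_mod.
  apply: run_rset_seq; rewrite !stride_expE /= !stride_expE /= h9 h10 h6 h7.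
  rewrite hT' nth_half_grown // hB'; last first.
    apply: (@leq_trans (i.+1 * d)); last by rewrite leq_mul2r hi orbT.
    by rewrite mulSn; lia.
  rewrite nth_flat_basis //.
  set s1 := rset _ _ _ _.
  have hT1 : holds s1 arr b (half_grown vs v k.+1).
    move=> x; rewrite half_grownS nth_rcons size_half_grown /=.
    have [->|hx] := eqVneq x (size vs * d + k)%N.
      by rewrite upd_eq ltnn.
    rewrite upd_neq; last by rewrite eqxx (inj_eq (@stride_inj b)).
    rewrite hT'; case: ltnP => // hx'.
    by rewrite nth_default // size_half_grown.
  have hB1 : holds_basis s1.
    move=> x hx; rewrite /= upd_neq ?hB' //.
    case/orP: harr => [|/andP[/negbTE -> hn]]; first by rewrite eq_sym => /negbTE ->.
    rewrite negb_and; apply/orP; right; rewrite /stride.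
    by have : (n * d <= size vs * d)%N; [rewrite leq_mul2r hn orbT|lia].
  have hR1 a x : a != arr -> rmem s1 a x = rmem s a x.
    by move=> ha; rewrite /= upd_neq_array // hR.
  apply: run_iset_seq; apply: run_iset_seq; apply: run_if => /=;
    rewrite /upd /= h01 h10 h9 => hd.
  + apply: run_iset => //; split=> //=.
    * by rewrite /upd /= addn1.
    * by rewrite /upd /= modS_case hd.
    * split=> // a x hax; rewrite /= !upd_neq ?hI //;
      by apply: contra hax => /andP[-> /eqP ->]; rewrite !inE.
  + apply: run_skip => //; split=> //=.
    * by rewrite /upd /= addn1.
    * by rewrite /upd /= modS_case (negbTE hd).
    * split=> // a x hax; rewrite /= !upd_neq ?hI //;
      by apply: contra hax => /andP[-> /eqP ->]; rewrite !inE.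
- by move=> s' [h9 _ [_ _ hI _]]; rewrite /= h9 hI // i6; lia.
- by move=> s' [_ _ []]; rewrite half_grown_full.
Qed.

Lemma grow_cmdP s arr b (vs : seq 'rV[R]_d) (i : nat) :
  holds s arr b (cells vs) -> holds_basis s ->
  (arr != 0%N) || (~~ b && (n <= size vs)%N) -> (i < n)%N ->
  imem s 0 1 = d -> imem s 2 6 = (size vs * d)%N -> imem s 2 7 = (i * d)%N ->
  imem s 2 8 = i ->
  run p (grow_cmd arr b) s (size vs * d * 6 + 7)
    (fun s' =>
       [/\ holds s' arr b (cells (grow vs (nth 0 (basis_seq B) i))),
           holds_basis s', keep_ints [:: 5; 6; 7; 8; 9; 10]%N s s',
           forall a x, a != arr -> rmem s' a x = rmem s a x &
           [/\ imem s' 2 5 = (imem s 2 5 + imem s 2 5)%N,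
               imem s' 2 6 = (size vs * d + size vs * d)%N,
               imem s' 2 7 = (i.+1 * d)%N & imem s' 2 8 = i.+1]]).
Proof.
move=> hT hB harr hi i01 i6 i7 i8; rewrite addnC.
apply: run_iset_seq; apply: run_iset_seq.
apply: run_seq; first by apply: (grow_loopP (vs := vs) (i := i)).
  move=> s' [hT' hB' hI hR].
  apply: run_iset_seq; apply: run_iset_seq; apply: run_iset_seq; apply: (@run_iset _ _ _ _ _ _ 1) => //.
  have e5 : imem s' 2 5 = imem s 2 5 by rewrite hI.
  have e6 : imem s' 2 6 = imem s 2 6 by rewrite hI.
  have e7 : imem s' 2 7 = imem s 2 7 by rewrite hI.
  have e8 : imem s' 2 8 = imem s 2 8 by rewrite hI.
  have e01 : imem s' 0 1 = imem s 0 1 by rewrite hI.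
  split=> //=.
    move=> a x hax; rewrite /= !upd_neq; try
      by apply: contra hax => /andP[-> /eqP ->]; rewrite !inE.
    rewrite hI /=; last by apply: contra hax => /andP[-> h]; rewrite !inE in h *; lia.
    by rewrite !upd_neq //; apply: contra hax => /andP[-> /eqP ->]; rewrite !inE.
  rewrite /upd /= e5 e6 e7 e8 e01 i6 i7 i8 i01; split=> //; first by rewrite mulSn addnC.
  by rewrite addn1.
by rewrite /=; lia.
Qed.

(** Every round is charged the final table size. This loses at most a factor [k], which poly(d)
    absorbs. *)
Lemma grow_allP s arr b (hi : iexp) (vs : seq 'rV[R]_d) (a k : nat) :
  (forall s', keep_ints [:: 5; 6; 7; 8; 9; 10]%N s s' -> ieval s' hi = (a + k)%N) ->
  holds s arr b (cells vs) -> holds_basis s ->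
  (arr != 0%N) || (~~ b && (n <= size vs)%N) -> (a + k <= n)%N ->
  imem s 0 1 = d -> imem s 2 6 = (size vs * d)%N -> imem s 2 7 = (a * d)%N ->
  imem s 2 8 = a ->
  run p (grow_all arr b hi) s (k * (size vs * 2 ^ k * d * 6 + 8)).+1
    (fun s' =>
       [/\ holds s' arr b (cells (grown B vs a k)),
           holds_basis s', keep_ints [:: 5; 6; 7; 8; 9; 10]%N s s',
           forall a' x, a' != arr -> rmem s' a' x = rmem s a' x &
           [/\ imem s' 2 5 = (imem s 2 5 * 2 ^ k)%N,
               imem s' 2 6 = (size vs * 2 ^ k * d)%N,
               imem s' 2 7 = ((a + k) * d)%N & imem s' 2 8 = (a + k)%N]]).
Proof.
move=> hhi hT hB harr hak i01 i6 i7 i8.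
pose Inv k s' := [/\ holds s' arr b (cells (grown B vs a k)),
           holds_basis s', keep_ints [:: 5; 6; 7; 8; 9; 10]%N s s',
           forall a' x, a' != arr -> rmem s' a' x = rmem s a' x &
           [/\ imem s' 2 5 = (imem s 2 5 * 2 ^ k)%N,
               imem s' 2 6 = (size vs * 2 ^ k * d)%N,
               imem s' 2 7 = ((a + k) * d)%N & imem s' 2 8 = (a + k)%N]].
apply: run_weaken (@run_while _ p _ _ Inv k (size vs * 2 ^ k * d * 6 + 7) _ _ _ _) _ _ => //.
- by split=> //; rewrite expn0 !muln1 !addn0; split.
- move=> k' s' hk' [hT' hB' hI hR [h5 h6 h7 h8]].
  split; first by rewrite /= h8 hhi //; lia.
  have hs : size (grown B vs a k') = (size vs * 2 ^ k')%N by exact: size_grown.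
  apply: run_weaken (grow_cmdP (vs := grown B vs a k') (i := (a + k')%N) _ _ _ _ _ _ _ _) _ _ => //.
  + rewrite hs; case/orP: harr => [->//|/andP[-> hn]]; apply/orP; right => /=.
    by apply: leq_trans hn _; rewrite leq_pmulr // expn_gt0.
  + lia.
  + by rewrite hI.
  + by rewrite hs.
  + rewrite hs leq_add2r !leq_mul2r; apply/orP; right; apply/orP; right.
    by rewrite leq_mul2l leq_pexp2l ?orbT // ltnW.
  + move=> s2 [hT2 hB2 hI2 hR2 [g5 g6 g7 g8]]; split=> //.
    * by move=> a' x hax; rewrite hI2 // hI.
    * by move=> a' x hax; rewrite hR2 // hR.
    * rewrite g5 g6 g7 g8 h5 hs expnS addnS; split=> //; lia.
- by move=> s' [_ _ hI _ [_ _ _ h8]]; rewrite /= h8 hhi //; lia.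
- by rewrite -addnS.
Qed.

End Program.

(** * One query on the versioned memory *)

Definition load_step : cmd :=
  Seq (RSet (real_array 1) (IAdd (IAdd (ivar 10) (ivar 10)) (INum 1))
         (ROpp (RGet 0 (IAdd (ivar 7) (ivar 10)))))
  (Seq (ISet (real_stamp 1) (ivar 10) (ivar 1))
       (iassign 10 (IAdd (ivar 10) (INum 1)))).

(* Increasing the version discards everything written by the previous query. *)
Definition query_cmd (qry : cmd) : cmd :=
  Seq (iassign 1 (IAdd (ivar 1) (INum 1)))
  (Seq (iassign 2 (ivar 1))
  (Seq (iassign 10 (INum 0))
  (Seq (While (ilt (ivar 10) (IGet 0 (INum 1))) load_step)
  (Seq (RSet (real_array 2) (INum 1) (RGet 2 (INum 0)))
  (Seq (ISet (real_stamp 2) (INum 0) (ivar 1))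
  (Seq (RSet (real_array 2) (INum 3) (RGet 2 (INum 1)))
  (Seq (ISet (real_stamp 2) (INum 1) (ivar 1))
  (Seq (sim_cmd qry)
  (Seq (If (ILe (INum 1) (sim_iexp (IGet 1 (INum 0)))) (ISet 1 (INum 0) (INum 1)) Skip)
       (iassign 7 (IAdd (ivar 7) (IGet 0 (INum 1))))))))))))).

Ltac arr_lia := rewrite /int_array /int_stamp /real_stamp /real_array; lia.

Section Query.
Variables (R : realType) (p : \bar R) (d : nat).
Implicit Types (s ph : store R) (v : 'rV[R]_d).

(** The invariant between queries: the base values are the store left by the preprocessing, and no
    stamp exceeds the version. Incrementing the version therefore restores that store in one
    step. *)
Record based s ph : Prop := Based {
  based_int : forall a i, imem ph (int_array a) (i + i)%N = imem s a i;
  based_real : forall a i, rmem ph (real_array a) (i + i)%N = rmem s a i;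
  based_int_stamp : forall a i, (imem ph (int_stamp a) i <= imem ph 2 1)%N;
  based_real_stamp : forall a i, (imem ph (real_stamp a) i <= imem ph 2 1)%N
}.

Record query_loaded ph (v : 'rV[R]_d) (j : nat) ph' : Prop := QueryLoaded {
  ql_counter : imem ph' 2 10 = j;
  ql_int : forall a i, a != real_stamp 1 -> ~~ ((a == 2) && (i == 10))%N ->
    imem ph' a i = imem ph a i;
  ql_stamp : forall i, imem ph' (real_stamp 1) i =
    if (i < j)%N then imem ph 2 1 else imem ph (real_stamp 1) i;
  ql_even : forall i, rmem ph' (real_array 1) (i + i)%N = rmem ph (real_array 1) (i + i)%N;
  ql_odd : forall i, (i < j)%N ->
    rmem ph' (real_array 1) (i + i + 1)%N = - nth 0 (flat v) i;
  ql_real : forall a i, a != real_array 1 -> rmem ph' a i = rmem ph a i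
}.

Lemma load_loopP ph v :
  imem ph 0 1 = d -> imem ph 2 10 = 0%N ->
  (forall j, (j < d)%N -> rmem ph 0 (imem ph 2 7 + j)%N = nth 0 (flat v) j) ->
  run p (While (ilt (ivar 10) (IGet 0 (INum 1))) load_step) ph (d * 4).+1
    (query_loaded ph v d).
Proof.
move=> i01 i10 hv.
apply: (@run_while _ p _ _ (query_loaded ph v) d 3) => //.
- move=> j ph' hj [h10 hI hS hE hO hR].
  have h01 : imem ph' 0 1 = d by rewrite hI.
  have h1 : imem ph' 2 1 = imem ph 2 1 by rewrite hI.
  have h7 : imem ph' 2 7 = imem ph 2 7 by rewrite hI.
  split; first by rewrite /= h10 h01; lia.
  apply: run_rset_seq; apply: run_iset_seq; apply: run_iset => //.
  rewrite /= h10 h7 hR // hv //.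
  split=> //=.
  + by rewrite upd_eq upd_neq_array // h10 addn1.
  + by move=> a i ha hai; rewrite !upd_neq //; [exact: hI|rewrite (negbTE ha)].
  + move=> i; rewrite upd_neq_array // /upd eqxx /= hS h1.
    by rewrite ltnS [(i <= j)%N]leq_eqVlt; case: eqP.
  + by move=> i; rewrite upd_neq ?hE //; lia.
  + move=> i hi; have [->|hij] := eqVneq i j; first by rewrite upd_eq.
    by rewrite upd_neq ?hO //; lia.
  + by move=> a i ha; rewrite upd_neq_array ?hR.
- by move=> ph' [h10 hI _ _ _ _]; rewrite /= h10 hI // i01; lia.
Qed.

(** The answer cell is only ever set to 1, so successive queries compute the disjunction of their
    answers. *)
Lemma query_cmdP (qry : cmd) s1 ph (gamma r : R) v t2 s2 :
  based s1 ph -> imem ph 0 1 = d -> rmem ph 2 0 = gamma -> rmem ph 2 1 = r ->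
  (forall j, (j < d)%N -> rmem ph 0 (imem ph 2 7 + j)%N = nth 0 (flat v) j) ->
  exec p qry (ann_query s1 gamma r (- v)) t2 s2 ->
  run p (query_cmd qry) ph (4 * d + 3 * t2 + 11)
    (fun ph' =>
       [/\ based s1 ph',
           forall a i, (a < 3)%N -> ~~ ((a == 2) && (i \in [:: 0; 1; 2; 7; 10]))%N ->
             ~~ ((a == 1) && (i == 0))%N -> imem ph' a i = imem ph a i,
           forall a i, (a < 3)%N -> rmem ph' a i = rmem ph a i,
           imem ph' 2 7 = (imem ph 2 7 + d)%N &
           imem ph' 1 0 = if accepts s2 then 1%N else imem ph 1 0]).
Proof.
move=> [bi br bsi bsr] i01 hg hr hv hq.
set q := (imem ph 2 1).+1.
apply: (@run_weaken _ _ _ _ ((d * 4).+1 + (3 * t2 + 3).+4).+3); [|lia|by move=> s'; exact].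
apply: run_iset_seq; apply: run_iset_seq; apply: run_iset_seq.
set ph0 := iset _ _ _ _.
have hI0 a i : a != 2%N -> imem ph0 a i = imem ph a i.
  by move=> ha; rewrite /= !upd_neq_array.
have hI2 i : i \notin [:: 1; 2; 10]%N -> imem ph0 2 i = imem ph 2 i.
  by move=> hi; rewrite /= !upd_neq //; apply: contra hi => /eqP ->.
(* Version and stamp are now both [q], so the simulated query writes its values to odd slots
   only. *)
have h1 : imem ph0 2 1 = q by rewrite /= /upd /= addn1.
have h2 : imem ph0 2 2 = q by rewrite /= /upd /= addn1.
apply: run_seq (leqnn _).
  by apply: (@load_loopP ph0 v) => //; rewrite hI0.
move=> ph1 [h10 hI hS hE hO hR].
apply: run_rset_seq; apply: run_iset_seq; apply: run_rset_seq; apply: run_iset_seq.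
have e1 : imem ph1 2 1 = q by rewrite hI.
have e2 : imem ph1 2 2 = q by rewrite hI.
set ph2 := iset _ _ _ _.
have g1 : imem ph2 2 1 = q by rewrite /= !upd_neq_array.
have g2 : imem ph2 2 2 = q by rewrite /= !upd_neq_array.
have gI a i : a != real_stamp 2 -> imem ph2 a i = imem ph1 a i.
  by move=> ha; rewrite /= !upd_neq_array.
have gR a i : a != real_array 2 -> rmem ph2 a i = rmem ph1 a i.
  by move=> ha; rewrite /= !upd_neq_array.
have gS i : imem ph2 (real_stamp 2) i =
    if (i < 2)%N then q else imem ph (real_stamp 2) i.
  rewrite /= -[imem (rset _ _ _ _)]/(imem ph1) /=.
  case: i => [|[|i]] /=; rewrite /upd /= ?e1 //.
  by rewrite hI // hI0.
have gE i : rmem ph2 (real_array 2) (i + i) = rmem ph (real_array 2) (i + i).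
  by rewrite /= !upd_neq ?hR //; lia.
(* Slots 1 and 3 are the current slots of cells 0 and 1, where the query program expects [gamma] and
   [r]. *)
have gO0 : rmem ph2 (real_array 2) 1 = gamma.
  by rewrite /= upd_neq // upd_eq hR.
have gO1 : rmem ph2 (real_array 2) 3 = r.
  by rewrite /= upd_eq upd_neq_array // hR.
have hR0 a i : rmem ph0 a i = rmem ph a i by [].
clearbody ph0 ph2.
have hsim : simulates (ann_query s1 gamma r (- v)) ph2.
  split=> a i; rewrite g1.
    rewrite gI; last by arr_lia.
    rewrite gI; last by arr_lia.
    rewrite hI; [|by arr_lia|by arr_lia].
    rewrite hI; [|by arr_lia|by arr_lia].
    rewrite !hI0; [|by arr_lia|by arr_lia].
    (* An old stamp is strictly below [q], so the truncated subtraction selects the base slot. *)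
    have -> : slot q (imem ph (int_stamp a) i) i = (i + i)%N.
      by have := bsi a i; rewrite /slot /q; lia.
    by rewrite bi.
  rewrite /= size_flat_row; have [->|ha2] := eqVneq a 2%N.
    rewrite gS; case: i => [|[|i]] /=; rewrite /slot ?subnn //=.
    have -> : (i.+2 + i.+2 + (1 - (q - imem ph (real_stamp 2) i.+2)) = i.+2 + i.+2)%N.
      by have := bsr 2%N i.+2; rewrite /q; lia.
    by rewrite gE br.
  rewrite /= gI; last by arr_lia.
  rewrite gR; last by arr_lia.
  have [->|ha1] := eqVneq a 1%N.
    rewrite hS h1 /=; case: ltnP => hi.
      by rewrite /slot subnn subn0 hO // nth_flat_rowN.
    rewrite hI0 // -br -hR0 -hE /slot; congr (rmem ph1 _ _).
    by have := bsr 1%N i; rewrite /q; lia.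
  rewrite /= hI; [|by arr_lia|by arr_lia].
  rewrite hR; last by arr_lia.
  rewrite hI0; last by arr_lia.
  have -> : slot q (imem ph (real_stamp a) i) i = (i + i)%N.
    by have := bsr a i; rewrite /slot /q; lia.
  by rewrite hR0 br.
have [t' [ph3 [e3 ht3 hsim3 [fI fR fsi fsr fbi fbr]]]] := sim_cmdP hq hsim.
have q3 : imem ph3 2 1 = q by rewrite fI.
rewrite g1 g2 in fsi fsr fbi fbr.
have gI3 a i : (a < 3)%N -> ~~ ((a == 2) && (i \in [:: 0; 1; 2; 10]))%N ->
    imem ph3 a i = imem ph a i.
  move=> ha hai; have hai0 : ~~ ((a == 2) && (i == 0))%N.
    by apply: contra hai => /andP[-> /eqP ->].
  rewrite fI // gI; last by arr_lia.
  rewrite hI; [|by arr_lia|by apply: contra hai => /andP[-> /eqP ->]].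
  have [ea|ha2] := eqVneq a 2%N; last exact: hI0.
  rewrite ea; apply: hI2; apply: contra hai => hi; rewrite ea /=.
  by move: hi; rewrite !inE => /or3P[] ->; rewrite ?orbT.
have gR3 a i : (a < 3)%N -> rmem ph3 a i = rmem ph a i.
  by move=> ha; rewrite fR // gR ?hR ?hR0 //; arr_lia.
have b3 : based s1 ph3.
  split.
  - move=> a i; rewrite fbi // gI; last by arr_lia.
    rewrite hI; [|by arr_lia|by arr_lia].
    by rewrite hI0 ?bi //; arr_lia.
  - move=> a i; rewrite fbr //; have [->|ha2] := eqVneq a 2%N; first by rewrite gE br.
    rewrite gR; last by arr_lia.
    have [->|ha1] := eqVneq a 1%N; first by rewrite hE hR0 br.
    by rewrite hR ?hR0 ?br //; arr_lia.
  - move=> a i; rewrite q3; case: (fsi a i) => -> //.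
    rewrite gI; last by arr_lia.
    rewrite hI; [|by arr_lia|by arr_lia].
    rewrite hI0; last by arr_lia.
    exact: leqW.
  - move=> a i; rewrite q3; case: (fsr a i) => -> //.
    have [->|ha2] := eqVneq a 2%N.
      by rewrite gS; case: ifP => // _; exact: leqW.
    rewrite gI; last by arr_lia.
    have [->|ha1] := eqVneq a 1%N.
      by rewrite hS h1; case: ifP => // _; rewrite hI0 //; exact: leqW.
    rewrite hI; [|by arr_lia|by arr_lia].
    rewrite hI0; last by arr_lia.
    exact: leqW.
have setout_based x y a : (a < 3)%N -> (a != 2)%N || (x != 1)%N -> based s1 (iset ph3 a x y) .
  move=> ha hx; case: b3 => b1 b2 b3' b4.
  split=> a' i /=; rewrite ?upd_neq ?b1 ?b2 ?b3' ?b4 //; try arr_lia.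
pose Q ph' := [/\ based s1 ph',
   forall a i, (a < 3)%N -> ~~ ((a == 2) && (i \in [:: 0; 1; 2; 10]))%N ->
             ~~ ((a == 1) && (i == 0))%N -> imem ph' a i = imem ph a i,
   forall a i, (a < 3)%N -> rmem ph' a i = rmem ph a i &
   imem ph' 1 0 = if accepts s2 then 1%N else imem ph 1 0].
apply: (@run_seq _ _ _ _ _ (3 * t2) 3 _ _ (fun s => s = ph3)); last by lia.
  by exists t', ph3.
move=> _ ->.
apply: (@run_seq _ _ _ _ _ 2 1 _ _ Q) => //.
  have hacc : beval p ph3 (ILe (INum 1) (sim_iexp (IGet 1 (INum 0)))) = accepts s2.
    rewrite -[LHS]/(1 <= ieval ph3 (sim_iexp (IGet 1 (INum 0))))%N (sim_iexpE _ hsim3) /=.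
    by rewrite lt0n.
  apply: run_if; rewrite hacc => ha.
    apply: run_iset => //; split=> //=.
    - exact: setout_based.
    - by move=> a i ha3 hai hai1; rewrite upd_neq // gI3.
    - by rewrite upd_eq ha.
  apply: run_skip => //; split=> //.
  - by move=> a i ha3 hai _; rewrite gI3.
  - by rewrite (negbTE ha) gI3.
move=> ph4 [[b41 b42 b43 b44] hI4 hR4 hO4]; apply: run_iset => //.
split=> //=.
- by split=> a' i /=; rewrite ?upd_neq ?b41 ?b42 ?b43 ?b44 //; arr_lia.
- move=> a i ha hai hai1; rewrite upd_neq; last by apply: contra hai => /andP[-> /eqP ->].
  by apply: hI4 => //; apply: contra hai => /andP[-> h]; rewrite !inE in h *; lia.
- by rewrite /upd /= !hI4 // i01.
Qed.

End Query.

(** * The whole program: tables, preprocessing, queries *)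

Definition tables_cmd (m : nat) : cmd :=
  Seq (split_cmd m)
  (Seq (iassign 5 (INum 1))
  (Seq (iassign 6 (IGet 0 (INum 1)))
  (Seq (grow_all (real_array 0) true (ivar 3))
  (Seq (ISet (int_array 0) (INum 0) (ivar 5))
  (Seq (ISet (int_array 0) (INum 2) (IGet 0 (INum 1)))
  (Seq (iassign 6 (INum 0))
  (Seq (iassign 9 (INum 0))
  (Seq (While (ilt (ivar 9) (IGet 0 (INum 0)))
          (Seq (iassign 6 (IAdd (ivar 6) (IGet 0 (INum 1))))
               (iassign 9 (IAdd (ivar 9) (INum 1)))))
       (grow_all 0 false (IGet 0 (INum 0))))))))))).

(** The preprocessing runs with version 1 and stamp 0, so that its writes go to the base slots; each
    query then starts by raising the version. *)
Definition svp_cmd (m : nat) (pre qry : cmd) : cmd :=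
  Seq (tables_cmd m)
  (Seq (iassign 1 (INum 1))
  (Seq (sim_cmd pre)
  (Seq (iassign 7 (INum 0))
       (While (ilt (ivar 7) (ivar 6)) (query_cmd qry))))).

Section Main.
Variables (R : realType) (p : \bar R) (n d : nat) (B : 'M[R]_(n, d)) (gamma r : R).
Hypothesis d_gt0 : (0 < d)%N.
Variable m : nat.
Hypothesis m_gt0 : (0 < m)%N.

Let n1 := (n %/ m)%N.
Let data := grown B [:: 0] 0 n1.
Let queries := grown B (basis_seq B) n1 (n - n1).
Let start := load (matrix_store B) 2 [:: gamma; r].

Lemma nth_cells0 k : nth 0 (cells [:: 0 : 'rV[R]_d]) k = 0.
Proof.
rewrite /cells /= cats0.
have [hk|hk] := ltnP k d; last by rewrite nth_default // size_flat_row.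
by rewrite -[k]/(nat_of_ord (Ordinal hk)) nth_flat_row mxE.
Qed.

Definition tables_time : nat :=
  (6 * n + n1 * (2 ^ n1 * d * 6 + 8) + (n - n1) * (n * 2 ^ (n - n1) * d * 6 + 8) + 11)%N.

Record tables_ready (s : store R) : Prop := TablesReady {
  tr_d : imem s 0 1 = d;
  tr_out : imem s 1 0 = 0%N;
  tr_w : imem s 2 2 = 0%N;
  tr_len : imem s 2 6 = (size queries * d)%N;
  tr_int : forall a i, (3 <= a)%N ->
    imem s a i = if (a == int_array 0) && (i == 0)%N then size data
                 else if (a == int_array 0) && (i == 2)%N then d else 0%N;
  tr_data : holds s (real_array 0) true (cells data);
  tr_queries : holds s 0 false (cells queries);
  tr_gamma : rmem s 2 0 = gamma;
  tr_r : rmem s 2 1 = r;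
  tr_real : forall a i, (real_array 0 < a)%N -> rmem s a i = 0
}.

Lemma tables_cmdP : run p (tables_cmd m) start tables_time tables_ready.
Proof.
have n1n : (n1 <= n)%N by exact: leq_div.
have -> : tables_time = ((3 * n + 2) + ((n1 * (1 * 2 ^ n1 * d * 6 + 8)).+1 +
    ((n * 3).+1 + ((n - n1) * (n * 2 ^ (n - n1) * d * 6 + 8)).+1).+4).+2)%N.
  by rewrite /tables_time mul1n; lia.
apply: run_seq (leqnn _).
  by apply: (@split_cmdP _ p m start).
move=> s1 [h3 hI1 hR1]; rewrite -[imem start 0 0]/n -/n1 in h3.
apply: run_iset_seq; apply: run_iset_seq; set s2 := iset _ _ _ _.
have hI2 a i : ~~ ((a == 2) && (i \in [:: 5; 6]))%N -> imem s2 a i = imem s1 a i.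
  by move=> hai; rewrite /= !upd_neq //; apply: contra hai => /andP[-> /eqP ->].
have h25 : imem s2 2 5 = 1%N by [].
have h26 : imem s2 2 6 = d.
  by rewrite -[LHS]/(imem s1 0 1) hI1.
have hR2 : rmem s2 = rmem start by rewrite /= hR1.
clearbody s2.
apply: run_seq (leqnn _).
  apply: (@grow_allP _ p n d B d_gt0 s2 (real_array 0) true (ivar 3) [:: 0] 0 n1) => //.
  - by move=> s' hs'; rewrite /= hs' // hI2.
  - by move=> k; rewrite nth_cells0 hR2.
  - by move=> k hk; rewrite hR2.
  - by rewrite hI2 // hI1.
  - by rewrite h26 mul1n.
  - by rewrite hI2 // hI1.
  - by rewrite hI2 // hI1.
move=> s3 [hT3 hB3 hI3 hR3 [h35 h36 h37 h38]].
apply: run_iset_seq; apply: run_iset_seq; apply: run_iset_seq; apply: run_iset_seq.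
have h301 : imem s3 0 1 = d by rewrite hI3 // hI2 // hI1.
set s4 := iset _ _ _ _.
have hI4 a i : a != int_array 0 -> ~~ ((a == 2) && (i \in [:: 6; 9]))%N ->
    imem s4 a i = imem s3 a i.
  move=> ha hai; rewrite /= !upd_neq //; try by rewrite (negbTE ha).
    by apply: contra hai => /andP[-> /eqP ->].
  by apply: contra hai => /andP[-> /eqP ->].
(* Physical positions 0 and 2 are the base slots of cells 0 and 1, the number of points and the
   dimension in the simulated input. *)
have hN4 i : imem s4 (int_array 0) i = if i == 0%N then size data
    else if i == 2%N then d else 0%N.
  rewrite -[LHS]/(upd (upd (imem s3) (int_array 0) 0 (imem s3 2 5)) (int_array 0) 2
    (imem s3 0 1) (int_array 0) i).
  rewrite /upd eqxx /= h35 h25 h301 /data size_grown !mul1n.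
  have [->//|_] := eqVneq i 2%N.
  case: eqP => // _.
  by rewrite hI3 // hI2 // hI1.
have hR4 : rmem s4 = rmem s3 by [].
have h46 : imem s4 2 6 = 0%N by [].
have h49 : imem s4 2 9 = 0%N by [].
clearbody s4.
pose Inv k s := [/\ imem s 2 6 = (k * d)%N, imem s 2 9 = k,
  keep_ints [:: 6; 9]%N s4 s & rmem s = rmem s4].
have h400 : imem s4 0 0 = n by rewrite hI4 // hI3 // hI2 // hI1.
have h401 : imem s4 0 1 = d by rewrite hI4.
apply: run_seq (leqnn _).
  (* There is no multiplication of naturals, so [n * d] is reached by adding [d] repeatedly. *)
  apply: (@run_while _ p _ _ Inv n 2) => //.
    move=> k s hk [i6 i9 hI hR]; split; first by rewrite /= i9 hI // h400; lia.
    apply: run_iset_seq; apply: run_iset => //; split=> //=.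
    - by rewrite /upd /= i6 hI // h401 mulSn addnC.
    - by rewrite /upd /= i9 addn1.
    - move=> a i hai; rewrite /= !upd_neq ?hI //;
      by apply: contra hai => /andP[-> /eqP ->].
  by move=> s [_ i9 hI _]; rewrite /= i9 hI // h400; lia.
move=> s5 [h56 h59 hI5 hR5].
(* Scalars 7 and 8 still point at row [n1], where the first growth stopped, so the query table is
   grown with the remaining rows. *)
apply: run_weaken (@grow_allP _ p n d B d_gt0 s5 0 false (IGet 0 (INum 0))
  (basis_seq B) n1 (n - n1) _ _ _ _ _ _ _ _ _) _ _ => //.
- by move=> s' hs'; rewrite /= hs' // hI5 // h400 subnKC.
- by move=> k; rewrite /stride hR5 hR4 hR3 // hR2 /= flat_cells.
- by move=> k hk; rewrite hR5 hR4 hB3.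
- by rewrite size_basis_seq /= leqnn.
- by rewrite subnKC.
- by rewrite hI5.
- by rewrite h56 size_basis_seq.
- by rewrite hI5 // hI4 // h37.
- by rewrite hI5 // hI4 // h38.
- by rewrite size_basis_seq.
move=> s6 [hT6 hB6 hI6 hR6 [h65 h66 h67 h68]]; split=> //.
- by rewrite hI6 // hI5.
- by rewrite hI6 // hI5 // hI4 // hI3 // hI2 // hI1.
- by rewrite hI6 // hI5 // hI4 // hI3 // hI2 // hI1.
- by rewrite h66 /queries size_grown.
- move=> a i ha.
  have ha2 : a != 2%N by lia.
  rewrite hI6 ?(negbTE ha2) // hI5 ?(negbTE ha2) //.
  have [->|han] := eqVneq a (int_array 0); first by rewrite hN4.
  rewrite hI4 ?(negbTE ha2) // hI3 ?(negbTE ha2) // hI2 ?(negbTE ha2) //.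
  rewrite hI1 ?(negbTE ha2) //=.
  by case: a ha {ha2 han}.
- by move=> k; rewrite hR6 // hR5 hR4 hT3.
- by rewrite hR6 // hR5 hR4 hR3 // hR2.
- by rewrite hR6 // hR5 hR4 hR3 // hR2.
- move=> a i ha; have ha0 : a != 0%N by lia.
  rewrite hR6 // hR5 hR4 hR3; last by lia.
  by rewrite hR2; move: ha; case: a {ha0} => [|[|[|a]]].
Qed.

Definition svp_time (t1 tq : nat) : nat :=
  (tables_time + 3 * t1 + size queries * (4 * d + 3 * tq + 12) + 3)%N.

(** The answer is a disjunction over the query table: [split_yes] supplies one accepting query, and
    [split_no] makes all of them reject. *)
Lemma svp_cmdP (pre qry : cmd) t1 tq s1 :
  exec p pre (matrix_store (vecs_mx data)) t1 s1 ->
  (forall v, exists t2 s2,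
     [/\ exec p qry (ann_query s1 gamma r (- v)) t2 s2, (t2 <= tq)%N,
         ann_yes p (vecs_mx data) r (- v) -> accepts s2 &
         ann_no p gamma (vecs_mx data) r (- v) -> ~~ accepts s2]) ->
  run p (svp_cmd m pre qry) start (svp_time t1 tq)
    (fun s => (svp_yes p B r -> accepts s) /\ (svp_no p gamma B r -> ~~ accepts s)).
Proof.
move=> hpre hqry.
have n1n : (n1 <= n)%N by exact: leq_div.
have -> : svp_time t1 tq =
    (tables_time + (3 * t1 + (size queries * (4 * d + 3 * tq + 11).+1).+1.+1).+1)%N.
  by rewrite /svp_time; lia.
apply: run_seq (leqnn _); first exact: tables_cmdP.
move=> s2 [td tout tw tlen tint tdata tquer tg tr treal].
apply: run_iset_seq; set s3 := iset _ _ _ _.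
have hI3 a i : ~~ ((a == 2) && (i == 1))%N -> imem s3 a i = imem s2 a i.
  by move=> hai; rewrite /= !upd_neq.
have h31 : imem s3 2 1 = 1%N by [].
have hR3 : rmem s3 = rmem s2 by [].
clearbody s3.
have stamp_int a i : imem s3 (int_stamp a) i = 0%N.
  by rewrite hI3 ?tint //; [case: ifP; [|case: ifP => //]|..]; arr_lia.
have stamp_real a i : imem s3 (real_stamp a) i = 0%N.
  by rewrite hI3 ?tint //; [case: ifP; [|case: ifP => //]|..]; arr_lia.
have hsim : simulates (matrix_store (vecs_mx data)) s3.
  split=> a i; rewrite h31 ?stamp_int ?stamp_real.
    rewrite /slot /= addn0 hI3 ?tint; [|by arr_lia|by arr_lia].
    have -> : (int_array a == int_array 0) = (a == 0%N) by arr_lia.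
    case: eqP => //= _; case: i => [|[|i]] //=.
    by rewrite nth_default //; case: eqP => //; lia.
  rewrite /slot /= addn0 hR3.
  case: a => [|a] /=; first by rewrite flat_vecs_mx -tdata.
  by rewrite treal //; arr_lia.
have [t' [s4 [e4 ht4 hsim4 [fI fR fsi fsr _ _]]]] := sim_cmdP hpre hsim.
have w3 : imem s3 2 2 = 0%N by rewrite hI3.
have q4 : imem s4 2 1 = 1%N by rewrite fI.
have stamp_int4 a i : imem s4 (int_stamp a) i = 0%N by case: (fsi a i) => ->.
have stamp_real4 a i : imem s4 (real_stamp a) i = 0%N by case: (fsr a i) => ->.
have b4 : based s1 s4.
  case: hsim4 => hi hr; split=> a i; rewrite ?hi ?hr ?stamp_int4 ?stamp_real4 //;
  by rewrite q4 /slot addn0.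
apply: (@run_seq _ _ _ _ _ (3 * t1) _ _ _ (fun s => s = s4)) (leqnn _).
  by exists t', s4.
move=> _ ->; apply: run_iset_seq; set s5 := iset _ _ _ _.
have h57 : imem s5 2 7 = 0%N by [].
have hI5 a i : ~~ ((a == 2) && (i == 7))%N -> imem s5 a i = imem s4 a i.
  by move=> hai; rewrite /= !upd_neq.
have hR5 : rmem s5 = rmem s4 by [].
have b5 : based s1 s5.
  case: b4 => b1 b2 b3 b4.
  by split=> a i; rewrite ?hI5 ?hR5 ?b1 ?b2 ?b3 ?b4 //; arr_lia.
clearbody s5.
(* Two separate implications instead of an equivalence: a query that meets neither promise may
   answer anything. *)
pose Inv k s := [/\ based s1 s, imem s 2 7 = (k * d)%N,
  forall a i, (a < 3)%N -> ~~ ((a == 2) && (i \in [:: 0; 1; 2; 7; 10]))%N ->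
             ~~ ((a == 1) && (i == 0))%N -> imem s a i = imem s2 a i,
  forall a i, (a < 3)%N -> rmem s a i = rmem s2 a i &
  ((exists2 k', (k' < k)%N &
      ann_yes p (vecs_mx data) r (- nth 0 queries k')) -> imem s 1 0 != 0%N) /\
  ((forall k', (k' < k)%N ->
      ann_no p gamma (vecs_mx data) r (- nth 0 queries k')) -> imem s 1 0 = 0%N)].
apply: run_weaken (@run_while _ p _ _ Inv (size queries) (4 * d + 3 * tq + 11) _ _ _ _) _ _ => //.
- split=> //.
  + move=> a i ha hai hai1; rewrite hI5; last first.
      by apply: contra hai => /andP[-> /eqP ->].
    rewrite fI //; last by apply: contra hai => /andP[-> /eqP ->].
    by rewrite hI3 //; apply: contra hai => /andP[-> /eqP ->].
  + by move=> a i ha; rewrite hR5 fR // hR3.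
  + by split=> [[]|] // _; rewrite hI5 // fI // hI3.
- move=> k s hk [hb h7 hI hR [hy hn]].
  split.
    rewrite /= h7 hI // tlen addn1.
    apply: (@leq_trans (k.+1 * d)); first by rewrite mulSn; lia.
    by rewrite leq_mul2r hk orbT.
  have [t2 [s2' [eq ht2 hacc hrej]]] := hqry (nth 0 queries k).
  apply: run_weaken (query_cmdP (v := nth 0 queries k) hb _ _ _ _ eq) _ _.
  + by rewrite hI.
  + by rewrite hR.
  + by rewrite hR.
  + move=> j hj; rewrite hR // h7 -[X in rmem s2 0 X]/(stride false _) tquer.
    exact: nth_cells.
  + lia.
  + move=> s' [hb' hI' hR' h7' ho']; split=> //.
    * by rewrite h7' h7 mulSn addnC.
    * by move=> a i ha hai hai1; rewrite hI' // hI.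
    * by move=> a i ha; rewrite hR' // hR.
    * rewrite ho'; split.
        move=> [k']; rewrite ltnS leq_eqVlt => /orP[/eqP -> /hacc ->//|hk' hy'].
        by case: ifP => // _; apply: hy; exists k'.
      move=> hno; rewrite (negbTE (hrej (hno k (leqnn _)))).
      by apply: hn => k' hk'; apply: hno; exact: leqW.
- by move=> s [_ h7 hI _ _]; rewrite /= h7 hI // tlen; lia.
move=> s [_ _ _ _ [hy hn]]; rewrite /accepts; split.
  move=> /(split_yes n1n) [v hv hyv]; apply: hy; exists (index v queries).
    by rewrite index_mem.
  by rewrite nth_index.
move=> hno; rewrite hn // => k' hk'; apply: split_no => //.
exact: mem_nth.
Qed.

End Main.

(** * Running time *)

(** With [n <= d] every polynomial factor becomes a power of [d]. The constant 58 gathers 6 from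
    growing the query table, 4 + 12 from running the queries, and 22 + 14 from the terms linear in
    [d] and the constants. *)
Lemma svp_time_le (n d m t1 tq : nat) (R : realType) (B : 'M[R]_(n, d)) :
  (0 < d)%N -> (n <= d)%N ->
  (svp_time B m t1 tq <= 6 * d ^ 3 * 2 ^ (n %/ m) + 58 * d ^ 3 * 2 ^ (n - n %/ m) +
     3 * t1 + 3 * d * (2 ^ (n - n %/ m) * tq))%N.
Proof.
move=> d0 nd; rewrite /svp_time /tables_time size_grown size_basis_seq.
have hn1 : (n %/ m <= n)%N by exact: leq_div.
have hn2 : (n - n %/ m <= n)%N by exact: leq_subr.
set n1 := (n %/ m)%N in hn1 hn2 *.
have N0 : (0 < 2 ^ n1)%N by rewrite expn_gt0.
have M0 : (0 < 2 ^ (n - n1))%N by rewrite expn_gt0.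
move: (2 ^ n1)%N (2 ^ (n - n1))%N N0 M0 => N M N0 M0.
have h1 : (n1 * (N * d * 6 + 8) <= d * (N * d * 6 + 8))%N by rewrite leq_mul2r; lia.
have h2 : ((n - n1) * (n * M * d * 6 + 8) <= d * (d * M * d * 6 + 8))%N.
  by rewrite leq_mul ?(leq_trans hn2) // leq_add2r !leq_mul2r nd !orbT.
have h3 : (n * M * (4 * d + 3 * tq + 12) <= d * M * (4 * d + 3 * tq + 12))%N.
  by rewrite !leq_mul2r nd !orbT.
have d2 : (d <= d ^ 2)%N by rewrite -{1}(expn1 d) leq_pexp2l.
have d3 : (d ^ 2 <= d ^ 3)%N by rewrite leq_pexp2l.
have e1 : (d ^ 2 * N <= d ^ 3 * N)%N by rewrite leq_mul2r d3 orbT.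
have e2 : (d * M <= d ^ 3 * M)%N by rewrite leq_mul2r (leq_trans d2 d3) orbT.
have e3 : (d ^ 2 * M <= d ^ 3 * M)%N by rewrite leq_mul2r d3 orbT.
have e4 : (d <= d * M)%N by rewrite leq_pmulr.
have h1' : (d * (N * d * 6 + 8) = 6 * (d ^ 2 * N) + 8 * d)%N by ring.
have h2' : (d * (d * M * d * 6 + 8) = 6 * (d ^ 3 * M) + 8 * d)%N by ring.
have h3' : (d * M * (4 * d + 3 * tq + 12) =
   4 * (d ^ 2 * M) + 3 * d * (M * tq) + 12 * (d * M))%N by ring.
lia.
Qed.

Section Exponents.
Variables (R : realType) (C delta : R) (m n : nat).
Hypotheses (hC : 1 <= C) (hd0 : 0 <= delta) (hd1 : delta <= 1).
Hypotheses (m_gt0 : (0 < m)%N) (hm : C + delta <= m%:R).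

Let n1 := (n %/ m)%N.

Lemma powR_expn k (e : R) : (2 ^ k)%:R `^ e = 2 `^ (k%:R * e).
Proof. by rewrite powRrM powR_mulrn // natrX. Qed.

Lemma quotient_mul_le : n1%:R * m%:R <= n%:R :> R.
Proof. by rewrite -natrM ler_nat leq_trunc_div. Qed.

Lemma quotient_mul_gt : n%:R < (n1%:R + 1) * m%:R :> R.
Proof. by rewrite -[1]/(1%:R) -natrD -natrM ltr_nat addn1 ltn_ceil. Qed.

Lemma divisor_gt0 : 0 < m%:R :> R.
Proof. by rewrite ltr0n. Qed.

(** Since [n1 <= n / m], the exponent [n1 * C] is at most [(m - delta) * (n / m)]; this is where [m]
    must be at least [C + delta]. *)
Lemma preprocessing_exponent :
  (2 ^ n1)%:R `^ C <= 2 `^ ((1 - delta / m%:R) * n%:R).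
Proof.
rewrite powR_expn ler_powR ?ler1n //.
have -> : (1 - delta / m%:R) * n%:R = (m%:R - delta) * (n%:R / m%:R).
  by field; rewrite lt0r_neq0 // divisor_gt0.
have h : n1%:R <= n%:R / m%:R :> R by rewrite ler_pdivlMr ?divisor_gt0 // quotient_mul_le.
rewrite mulrC; apply: ler_pM => //; first exact: le_trans hC.
by rewrite lerBrDr.
Qed.

(** The exponent is [n - delta * n1]. Rounding [n / m] down to [n1] costs at most [delta <= 1] in
    it, hence the factor 2. *)
Lemma query_exponent :
  (2 ^ (n - n1))%:R * (2 ^ n1)%:R `^ (1 - delta) <=
    2 * 2 `^ ((1 - delta / m%:R) * n%:R).
Proof.
rewrite powR_expn natrX -powR_mulrn // -powRD; last by rewrite pnatr_eq0 implybT.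
rewrite -[X in X * 2 `^ _]powRr1 // -powRD; last by rewrite pnatr_eq0 implybT.
rewrite ler_powR ?ler1n // natrB ?leq_div //.
have -> : (1 - delta / m%:R) * n%:R = n%:R - delta * (n%:R / m%:R).
  by field; rewrite lt0r_neq0 // divisor_gt0.
have h : n%:R / m%:R <= n1%:R + 1 :> R by rewrite ler_pdivrMr ?divisor_gt0 // ltW // quotient_mul_gt.
have : delta * (n%:R / m%:R) <= delta * (n1%:R + 1) by exact: ler_wpM2l.
rewrite mulrBr mulrDr !mulr1 [n1%:R * delta]mulrC.
move: hd1 (delta * (n%:R / m%:R)) (delta * n1%:R) (n1%:R : R) (n%:R : R).
by move=> {h} ? ? ? ? ?; lra.
Qed.

End Exponents.

(** In the constants, 122 = 6 + 58 * 2 and 9 = 3 + 3 * 2, each factor 2 coming from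
    [query_exponent]. *)
Lemma time_bound (R : realType) (K C delta : R) (k n d m t1 tq : nat) (B : 'M[R]_(n, d)) :
  1 <= C -> 0 <= delta -> delta <= 1 -> (0 < m)%N -> C + delta <= m%:R ->
  (0 < d)%N -> (n <= d)%N -> 0 <= K ->
  t1%:R <= K * d%:R ^+ k * (2 ^ (n %/ m))%:R `^ C ->
  tq%:R <= K * d%:R ^+ k * (2 ^ (n %/ m))%:R `^ (1 - delta) ->
  (svp_time B m t1 tq)%:R <=
    (122 + 9 * K) * d%:R ^+ (k + 3) * 2 `^ ((1 - delta / m%:R) * n%:R).
Proof.
move=> hC hd0 hd1 m0 hm d0 nd K0 ht1 htq.
have hpre := preprocessing_exponent n hC m0 hm.
have hqry := query_exponent n hd0 hd1 m0.
set P := 2 `^ _ in hpre hqry *.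
set N := (2 ^ (n %/ m))%N in ht1 htq hpre hqry.
set M := (2 ^ (n - n %/ m))%N in hqry.
have P0 : 0 <= P by exact: powR_ge0.
have N1 : 1 <= N%:R :> R by rewrite ler1n expn_gt0.
have NP : N%:R <= P.
  by apply: le_trans hpre; rewrite -[X in X <= _]powRr1 ?ler_powR // (le_trans _ N1).
have MP : M%:R <= 2 * P.
  apply: le_trans hqry; rewrite ler_peMr //.
  by rewrite -[X in X <= _](powRr0 N%:R) ler_powR // subr_ge0.
have dge1 : 1 <= d%:R :> R by rewrite ler1n.
set X := d%:R ^+ (k + 3).
have X3 : d%:R ^+ 3 <= X :> R by rewrite ler_weXn2l // leq_addl.
have Xk : d%:R ^+ k <= X :> R by rewrite ler_weXn2l // leq_addr.
have Xk1 : d%:R * d%:R ^+ k <= X :> R by rewrite -exprS ler_weXn2l // addnS ltnS leq_addr.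
have D3 : 0 <= d%:R ^+ 3 :> R by rewrite exprn_ge0.
have Dk : 0 <= d%:R ^+ k :> R by rewrite exprn_ge0.
have := svp_time_le m t1 tq B d0 nd; rewrite -/N -/M -(ler_nat R) => h.
have eh : (6 * d ^ 3 * N + 58 * d ^ 3 * M + 3 * t1 + 3 * d * (M * tq))%:R =
    6 * (d%:R ^+ 3 * N%:R) + 58 * (d%:R ^+ 3 * M%:R) + 3 * t1%:R +
    3 * (d%:R * (M%:R * tq%:R)) :> R.
  by clear; clearbody N M; ring.
apply: le_trans h _; rewrite eh.
have a1 : d%:R ^+ 3 * N%:R <= X * P by exact: ler_pM.
have a2 : d%:R ^+ 3 * M%:R <= X * (2 * P) by exact: ler_pM.
have a3 : t1%:R <= K * (X * P).
  apply: le_trans ht1 _; rewrite -mulrA ler_wpM2l // ler_pM // powR_ge0.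
have a4 : d%:R * (M%:R * tq%:R) <= K * (X * (2 * P)).
  have := ler_wpM2l (_ : 0 <= d%:R * M%:R) htq.
  rewrite mulr_ge0 // => /(_ isT) h; rewrite mulrA; apply: le_trans h _.
  have -> : d%:R * M%:R * (K * d%:R ^+ k * N%:R `^ (1 - delta)) =
    K * ((d%:R * d%:R ^+ k) * (M%:R * N%:R `^ (1 - delta))) by ring.
  by apply: ler_wpM2l => //; exact: ler_pM.
clear -a1 a2 a3 a4; clearbody N M P X; lra.
Qed.

(** * The range of [delta] and the final reduction *)

(** For [delta > 1] the query bound tends to 0 as [N] grows, while a run takes at least one step.
    Points with all coordinates equal to [i] give inputs of every size. *)
Lemma ann_delta_le1 (R : realType) (p : \bar R) (D : nat -> Prop) (gamma C delta : R) d :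
  has_ann_algorithm p D gamma C delta -> (0 < d)%N -> D d -> delta <= 1.
Proof.
move=> [pre [qry [K [k H]]]] d0 Dd; rewrite leNgt; apply/negP => hd.
set L := K * d%:R ^+ k.
have hL (N : nat) : (0 < N)%N -> 1 <= L * N%:R `^ (1 - delta).
  move=> N0; pose A : 'M[R]_(N, d) := \matrix_(i, j) i%:R.
  have injA : injective (fun i => row i A).
    move=> i i' /rowP /(_ (Ordinal d0)); rewrite !mxE => /eqP.
    by rewrite eqr_nat => /eqP /val_inj.
  have [t1 [s1 [_ _ hq]]] := H N d A N0 d0 Dd injA.
  have [t2 [s2 [e ht _ _]]] := hq 1 0 ltr01.
  by apply: le_trans ht; rewrite ler1n; exact: exec_gt0 e.
pose e := delta - 1.
have e0 : 0 < e by rewrite subr_gt0.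
(* Chosen so that [y] to the power [e] is [|L| + 1]: any [N > y] pushes the bound below 1. *)
pose y := (`|L| + 1) `^ e^-1.
pose N := (Num.truncn y).+1.
have yN : y < N%:R by exact: truncnS_gt.
have L1 : 0 < `|L| + 1 by apply: ltr_wpDl.
have h : `|L| + 1 <= N%:R `^ e.
  have -> : `|L| + 1 = y `^ e by rewrite /y -powRrM mulVf ?powRr1 ?ltW // gt_eqF.
  by rewrite ge0_ler_powR ?nnegrE ?powR_ge0 // ltW.
have := hL N isT; rewrite leNgt => /negP; apply.
have -> : 1 - delta = - e by rewrite /e opprB.
have Ne0 : 0 < N%:R `^ e by apply: powR_gt0; rewrite ltr0n.
rewrite powRN ltr_pdivrMr // mul1r; apply: lt_le_trans h.
by apply: le_lt_trans (ler_norm L) _; rewrite ltrDl.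
Qed.

(* The constant c hidden in delta' = Omega(delta / (C - 1)) is uniform in all the
   parameters as long as C stays bounded away from 1.  It cannot be uniform down
   to C = 1, where delta / (C - 1) is unbounded while delta' > 1 is absurd. *)
Theorem theorem3p5 (R : realType) (C0 : R) (hC0 : 1 < C0) :
  exists2 c : R, 0 < c &
  forall (p : \bar R) (D : nat -> Prop) (gamma delta C : R),
    (1 <= p)%E -> 1 < gamma -> 0 < delta -> C0 <= C ->
    has_ann_algorithm p D gamma C delta ->
    exists2 delta' : R, c * (delta / (C - 1)) <= delta' &
      has_svp_algorithm p D gamma delta'.
Proof.
have C02 : 0 < C0 + 2 by lra.
exists ((C0 - 1) / (C0 + 2)); first by apply: divr_gt0 => //; lra.
move=> p D gamma delta C _ _ hd hC hann.
have C1 : 0 < C - 1 by lra.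
pose m := (Num.truncn (C + delta)).+1.
have m0 : (0 < m)%N by [].
have mR : 0 < m%:R :> R by rewrite ltr0n.
have hm : C + delta <= m%:R by rewrite ltW // truncnS_gt.
(* If no positive dimension is admissible, [ann_delta_le1] does not apply, but the SVP claim is
   vacuous. *)
have [[d d0 Dd]|noD] := pselect (exists2 d, (0 < d)%N & D d); last first.
  exists ((C0 - 1) / (C0 + 2) * (delta / (C - 1))) => //.
  exists Skip, 0, 0%N => n d B r d0 Dd; exfalso; apply: noD; by exists d.
have hd1 := ann_delta_le1 hann d0 Dd.
exists (delta / m%:R).
  (* By [delta <= 1], [m <= C + delta + 1 <= C + 2]. *)
  have mC : m%:R <= C + 2.
    rewrite /m -natr1; have : (Num.truncn (C + delta))%:R <= C + delta.
      by rewrite truncn_le; lra.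
    by lra.
  rewrite mulrCA ler_pM2l // ler_pdivrMr // [m%:R^-1 * _]mulrC ler_pdivlMr //.
  rewrite mulrAC ler_pdivrMr //.
  (* The remaining gap [(C - 1) * (C0 + 2) - (C0 - 1) * (C + 2)] equals [3 * (C - C0)]. *)
  have : (C0 - 1) * m%:R <= (C0 - 1) * (C + 2) by apply: ler_wpM2l => //; lra.
  by lra.
move: hann => [pre [qry [K [k H]]]] {d d0 Dd}.
(* [m] depends on [C] and [delta] only, so it may occur as a numeral in the program. The absolute
   value guards against a negative [K]. *)
exists (svp_cmd m pre qry), (122 + 9 * `|K|), (k + 3)%N => n d B r d0 Dd fB r0.
have n1n : (n %/ m <= n)%N by exact: leq_div.
set data := grown B [:: 0] 0 (n %/ m).
have size_data : size data = (2 ^ (n %/ m))%N by rewrite size_grown mul1n.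
have data0 : (0 < size data)%N by rewrite size_data expn_gt0.
have inj : injective (fun i => row i (vecs_mx data)).
  move=> i j; rewrite !row_vecs_mx => /eqP.
  by rewrite nth_uniq ?uniq_grown // => /eqP /val_inj.
have [t1 [s1 [e1 ht1 hq]]] := H _ _ (vecs_mx data) data0 d0 Dd inj.
have absK x : 0 <= x -> K * d%:R ^+ k * x <= `|K| * d%:R ^+ k * x.
  by move=> x0; rewrite !ler_wpM2r ?exprn_ge0 // ler_norm.
set b := `|K| * d%:R ^+ k * (2 ^ (n %/ m))%:R `^ (1 - delta).
have b0 : 0 <= b by rewrite !mulr_ge0 ?exprn_ge0 ?powR_ge0.
have hqry v : exists t2 s2,
    [/\ exec p qry (ann_query s1 gamma r (- v)) t2 s2, (t2 <= Num.truncn b)%N,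
        ann_yes p (vecs_mx data) r (- v) -> accepts s2 &
        ann_no p gamma (vecs_mx data) r (- v) -> ~~ accepts s2].
  have [t2 [s2 [e2 ht2 hy hn]]] := hq r (- v) r0.
  exists t2, s2; split=> //; rewrite truncn_ge_nat //; apply: le_trans ht2 _.
  by rewrite size_data; apply: absK; exact: powR_ge0.
have [t [s [e ht [hy hn]]]] := svp_cmdP d0 m0 e1 hqry.
exists t, s; split=> //.
(* Linear independence bounds the rank by the dimension, so poly(d) absorbs the factors [n]. *)
have nd : (n <= d)%N by rewrite -(eqP fB) rank_leq_col.
apply: le_trans (_ : (svp_time B m t1 (Num.truncn b))%:R <= _); first by rewrite ler_nat.
apply: (@time_bound _ _ C) => //; [lra|lra| |].
  apply: le_trans ht1 _; rewrite size_data; apply: absK; exact: powR_ge0.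
by rewrite truncn_le.
Qed.
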